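(* Let $L>0$, $\Omega=(0,L)$, $p>0$, $\lambda,\kappa,\gamma>0$, $\alpha,\beta,\mu\in\mathbb{R}$, let $N$ be a positive integer and $h=L/N$. For $k=1,\dots,N$ let $x_k,\bar x_k\in J_k=\left[\frac{(k-1)L}{N},\frac{kL}{N}\right)$. Assume $\lambda\ge\mu h^2$ and $\frac{\mu}{4}>\gamma$. Let $u$ be a (sufficiently regular, complex-valued) solution of $$u_t-(\lambda+i\alpha)u_{xx}+(\kappa+i\beta)|u|^p u-\gamma u=-\mu\sum_{k=1}^{N}h\,u(\bar x_k)\,\delta(x-x_k),\quad x\in(0,L),\ t>0,$$ $$u(0,t)=u(L,t)=0,\quad t>0,$$ with initial value $u_0=u(\cdot,0)$. Then for all $t\ge0$, $$\|u(t)\|_{L^2(\Omega)}\le e^{-\left[\lambda_1(\lambda-\mu h^2)+\left(\frac{\mu}{4}-\gamma\right)\right]t}\,\|u_0\|_{L^2(\Omega)}.$$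
   Context: $\delta(x-x_k)$ is the Dirac mass at $x_k$, and $u(\bar x_k)$ stands for $u(\bar x_k,t)$ (here $\bar x_k$ is just a second point of $J_k$; the bar is not conjugation). $\lambda_1$ is the first eigenvalue of $-\frac{d^2}{dx^2}$ on $(0,L)$ with homogeneous Dirichlet boundary conditions, i.e. $\lambda_1=\pi^2/L^2$. The equation is understood in $H^{-1}(0,L)$, with $u(t)\in H^1_0(0,L)$. The existence of the solution is assumed. ''Sufficiently regular'' means regular enough that the equation may be paired with $u(t)$ in the $H^{-1}$-$H^1_0$ duality, giving $\mathrm{Re}\langle u_t,u\rangle=\frac12\frac{d}{dt}\|u(t)\|_{L^2}^2$; for definiteness one may take $u\in C([0,\infty);H^1_0(0,L))$ with $u_t\in L^2_{\mathrm{loc}}([0,\infty);H^{-1}(0,L))$. *)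

(* Defs.v *)
From HB Require Import structures.
From mathcomp Require Import all_boot all_order all_algebra.
From mathcomp Require Import all_classical all_reals all_analysis.
From mathcomp Require Import complex.

Set Implicit Arguments.
Unset Strict Implicit.
Unset Printing Implicit Defensive.

Import Order.TTheory GRing.Theory Num.Theory.
Import numFieldNormedType.Exports.

Local Open Scope classical_set_scope.
Local Open Scope ring_scope.
Local Open Scope complex_scope.

(* The modulus of a complex number, as an element of [R] (the library norm
   [`|z|] lies in [R[i]]). *)
Definition cmod (R : realType) (z : R[i]) : R := Normc.normc z.

(* MathComp-Analysis integrates real functions only, and [R[i]] has no
   measurable structure: both are handled through real and imaginary parts. *)
Definition cmeasurable (R : realType) (D : set R) (f : R -> R[i]) : Prop :=
  measurable_fun D (fun x => complex.Re (f x)) /\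
  measurable_fun D (fun x => complex.Im (f x)).

Definition cintegral (R : realType) (D : set R) (f : R -> R[i]) : R[i] :=
  (\int[@lebesgue_measure R]_(x in D) complex.Re (f x)) +i*
  (\int[@lebesgue_measure R]_(x in D) complex.Im (f x)).

Definition squareIntegrable (R : realType) (L : R) (f : R -> R[i]) : Prop :=
  cmeasurable `]0, L[ f /\
  (\int[@lebesgue_measure R]_(x in `]0%R, L[) ((cmod (f x)) ^+ 2)%:E < +oo)%E.

Definition L2norm (R : realType) (L : R) (f : R -> R[i]) : R :=
  Num.sqrt (\int[@lebesgue_measure R]_(x in `]0, L[) (cmod (f x)) ^+ 2).

(* Antilinear in the second argument, like all the pairings below. *)
Definition L2prod (R : realType) (L : R) (f g : R -> R[i]) : R[i] :=
  cintegral `]0, L[ (fun x => f x * conjc (g x)).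

(* [H10 L f f']: [f] is (the continuous representative on [0, L] of) an element
   of H^1_0(0,L) with weak derivative [f']; that is, [f] is absolutely
   continuous on [0, L], its derivative is in L^2(0,L), and it vanishes at both
   ends.  Values of [f] outside [0, L] are irrelevant.  [f'] is determined by
   [f] up to a null set, so that quantifying over both amounts to
   quantifying over [f]. *)
Definition H10 (R : realType) (L : R) (f f' : R -> R[i]) : Prop :=
  [/\ squareIntegrable L f',
      forall x : R, x \in `[0, L] -> f x = cintegral `[0, x] f' &
      f L = 0].

Definition H1norm (R : realType) (L : R) (f f' : R -> R[i]) : R :=
  Num.sqrt (L2norm L f ^+ 2 + L2norm L f' ^+ 2).

(* H^{-1}(0,L) as the antidual of H^1_0(0,L): [l phi] is the duality pairing
   <l, phi>, and an L^2 function [f] is identified with [L2prod L f].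
   Boundedness makes [l phi] independent of the values of [phi] outside
   [0, L]. *)
Definition Hm1 (R : realType) (L : R) (l : (R -> R[i]) -> R[i]) : Prop :=
  (forall (c : R[i]) phi phi' psi psi', H10 L phi phi' -> H10 L psi psi' ->
     l (fun x => c * phi x + psi x) = conjc c * l phi + l psi) /\
  (exists C : R, forall phi phi', H10 L phi phi' ->
     cmod (l phi) <= C * H1norm L phi phi').

Definition Hm1norm (R : realType) (L : R) (l : (R -> R[i]) -> R[i]) : \bar R :=
  ereal_sup [set y | exists phi phi',
    [/\ H10 L phi phi', H1norm L phi phi' <= 1 & y = (cmod (l phi))%:E]].

(* v is in L^2_loc([0,oo); H^{-1}(0,L)).  H^1_0(0,L) being separable, strong
   and weak measurability coincide. *)
Definition L2loc_Hm1 (R : realType) (L : R)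
    (v : R -> (R -> R[i]) -> R[i]) : Prop :=
  [/\ forall t : R, 0 <= t -> Hm1 L (v t),
      forall phi phi', H10 L phi phi' ->
        cmeasurable `[0, +oo[ (fun t => v t phi) &
      forall T : R, 0 <= T ->
        (\int[@lebesgue_measure R]_(t in `[0%R, T]) (Hm1norm L (v t)) ^+ 2
           < +oo)%E].

(* u is in C([0,oo); H^1_0(0,L)), with u(t)_x = ux t. *)
Definition continuous_H10 (R : realType) (L : R) (u ux : R -> R -> R[i]) :
    Prop :=
  (forall t : R, 0 <= t -> H10 L (u t) (ux t)) /\
  (forall t : R, 0 <= t ->
     H1norm L (fun x => u s x - u t x) (fun x => ux s x - ux t x)
       @[s --> within `[0, +oo[ (nbhs t)] --> (0 : R)).

(* The H^{-1}-valued time derivative of u is v : u(t) - u(s) is the integral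
   of v over [s, t], an identity in H^{-1}(0,L). *)
Definition time_derivative (R : realType) (L : R) (u : R -> R -> R[i])
    (v : R -> (R -> R[i]) -> R[i]) : Prop :=
  forall s t : R, 0 <= s -> s <= t -> forall phi phi', H10 L phi phi' ->
    L2prod L (u t) phi - L2prod L (u s) phi =
      cintegral `[s, t] (fun r => v r phi).

(* The equation holds in H^{-1}(0,L) for almost every t > 0; -u_xx is the
   functional phi |-> \int u_x * conjc phi_x and delta(x - a) is the functional
   phi |-> conjc (phi a).  The k : 'I_N range from 0 to N - 1. *)
Definition nodal_feedback_cgl (R : realType)
    (L p lambda kappa gamma alpha beta mu : R) (N : nat) (xs xbars : 'I_N -> R)
    (u : R -> R -> R[i]) : Prop :=
  exists (ux : R -> R -> R[i]) (ut : R -> (R -> R[i]) -> R[i]),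
    [/\ continuous_H10 L u ux,
        L2loc_Hm1 L ut,
        time_derivative L u ut &
        {ae @lebesgue_measure R, forall t : R, 0 < t ->
          forall phi phi', H10 L phi phi' ->
            ut t phi
            + (lambda +i* alpha) * L2prod L (ux t) phi'
            + (kappa +i* beta) *
                L2prod L (fun x => (cmod (u t x) `^ p)%:C * u t x) phi
            - gamma%:C * L2prod L (u t) phi
            = - mu%:C *
                \sum_(k < N) (L / N%:R)%:C * u t (xbars k) * conjc (phi (xs k))}].

Definition dirichlet_eigenvalue (R : realType) (L e : R) : Prop :=
  exists f f' : R -> R[i],
    [/\ H10 L f f',
        exists2 x, x \in `[0, L] & f x <> 0 &
        forall phi phi', H10 L phi phi' ->
          L2prod L f' phi' = e%:C * L2prod L f phi].

Definition first_dirichlet_eigenvalue (R : realType) (L e : R) : Prop :=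
  dirichlet_eigenvalue L e /\
  forall e', dirichlet_eigenvalue L e' -> e <= e'.

(* Main.v *)
Require Import Defs.
From HB Require Import structures.
From mathcomp Require Import all_boot all_order all_algebra.
From mathcomp Require Import all_classical all_reals all_analysis.
From mathcomp Require Import complex.
From mathcomp Require Import measurable_realfun.
From mathcomp Require Import ring lra.

(** Write h = L / N and let y(t) be the square of the L^2 norm of u(t).  The
    proof is an energy estimate: it shows y' + 2 omega y <= 0, where
    omega = lambda1 (lambda - mu h^2) + mu / 4 - gamma.

    Space.  Pair the equation with u itself and take real parts: alpha and
    beta disappear, and the kappa term has the good sign.  What remains to be
    seen is that the nodal feedback controls gamma.  On a cell of length h, a
    function oscillates by at most the square root of h times the L^2 norm of
    its derivative on that cell, so that moving the two sampling points around
    in the cell costs a multiple of h^2 |u_x|^2; this gives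
      sum_k h Re (u(xbar_k) conj u(x_k)) >= |u|^2 / 4 - h^2 |u_x|^2
    ([nodal_sampling]).  The loss is absorbed by the diffusion lambda |u_x|^2,
    and the diffusion that is left, lambda - mu h^2 >= 0, is turned into damping
    by the Poincare inequality lambda1 |u|^2 <= |u_x|^2.  All these
    inequalities are quadratic, hence proved for real functions and added up
    over real and imaginary parts ([cgl_form_coercive]).

    Poincare inequality.  As lambda1 is only known to be the least Dirichlet
    eigenvalue, two facts are used: (pi/L)^2 is an eigenvalue, and the
    inequality holds with the constant (pi/L)^2.  The latter ([wirtinger]) is
    a Schur test: on the left half of the interval,
      g(x)^2 <= (int_0^x cos(k y) dy) (int_0^x g'(y)^2 / cos(k y) dy)
    with k = pi/L by a weighted Cauchy-Schwarz inequality, and integrating in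
    x and exchanging the integrals gives exactly k^-2 int g'^2, since
    integrating cos(k .) from 0 and the result up to L / 2 gives cos(k .) / k^2
    back; the right half is symmetric.  Equality holds for sin(k .), which
    therefore minimizes the quadratic form int g'^2 - k^2 int g^2; its first
    variation vanishes there, and this is the weak eigenvalue equation
    ([weak_sin_mode]).

    Time.  The derivative u_t is only known weakly, against fixed test
    functions.  Taking u(t) + u(s) as the test function gives
      y(t) - y(s) = int_s^t Re <u_t(r), u(t) + u(s)> dr,
    and for r in [s, t] the argument u(t) + u(s) differs from 2 u(r) by
    something small in H^1, uniformly as t tends to s.  Replacing u_t(r) by
    the other terms of the equation, which are bounded on H^1 locally uniformly
    in r ([cgl_form_bound]), one finds that the upper right Dini derivative of y
    at s is at most - 2 omega y(s), for every s ([energy_dini]).  A continuous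
    function with such a Dini derivative decays exponentially
    ([dini_exponential_decay]). *)

Set Implicit Arguments.
Unset Strict Implicit.
Unset Printing Implicit Defensive.

Import Order.TTheory GRing.Theory Num.Theory.
Import numFieldNormedType.Exports.

Local Open Scope classical_set_scope.
Local Open Scope ring_scope.
Local Open Scope complex_scope.

(** * Square-integrable real functions *)

Section SquareIntegrableReal.
Variable R : realType.
Notation mu := (@lebesgue_measure R).
Implicit Types (D : set R) (f g : R -> R).

Lemma Rintegrable_eq D f g : measurable D -> (forall x, D x -> f x = g x) ->
  mu.-integrable D (EFin \o f) -> mu.-integrable D (EFin \o g).
Proof.
by move=> mD fg; apply: eq_integrable => // x /set_mem Dx /=; rewrite fg.
Qed.

Lemma RintegrableD D f g : measurable D ->
  mu.-integrable D (EFin \o f) -> mu.-integrable D (EFin \o g) ->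
  mu.-integrable D (EFin \o (fun x => f x + g x)).
Proof.
move=> mD fi gi.
exact: (@eq_integrable _ _ _ mu _ mD _ _ _ (@integrableD _ _ _ mu _ mD _ _ fi gi)).
Qed.

Lemma RintegrableZ D (c : R) f : measurable D ->
  mu.-integrable D (EFin \o f) ->
  mu.-integrable D (EFin \o (fun x => c * f x)).
Proof.
move=> mD fi.
exact: (@eq_integrable _ _ _ mu _ mD _ _ _ (@integrableZl _ _ _ mu _ mD c _ fi)).
Qed.

Lemma bounded_integrable D f M : measurable D -> (mu D < +oo)%E ->
  measurable_fun D f -> (forall x, D x -> `|f x| <= M) ->
  mu.-integrable D (EFin \o f).
Proof.
move=> mD Dfin mf fM; apply: measurable_bounded_integrable => //.
exists M; split; first exact: num_real.
by move=> y My x Dx /=; apply: le_trans (fM x Dx) _; exact: ltW.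
Qed.

Definition L2fun D f :=
  measurable_fun D f /\ mu.-integrable D (EFin \o (fun x => f x ^+ 2)).

Lemma L2funM_integrable D f g : measurable D -> L2fun D f -> L2fun D g ->
  mu.-integrable D (EFin \o (fun x => f x * g x)).
Proof.
move=> mD [mf f2] [mg g2].
apply: (@le_integrable _ _ _ mu _ mD _ _ _ _ (RintegrableD mD f2 g2)).
- by apply/measurable_EFinP; exact: measurable_funM.
- move=> x Dx /=; rewrite lee_fin.
  rewrite [leRHS]ger0_norm ?addr_ge0 ?sqr_ge0// ler_norml.
  have := sqr_ge0 (f x + g x); have := sqr_ge0 (f x - g x).
  have := sqr_ge0 (f x); have := sqr_ge0 (g x).
  by rewrite sqrrB sqrrD => *; apply/andP; split; lra.
Qed.

Lemma L2funD D f g : measurable D -> L2fun D f -> L2fun D g ->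
  L2fun D (fun x => f x + g x).
Proof.
move=> mD Lf Lg; have fg := L2funM_integrable mD Lf Lg.
case: Lf Lg => [mf f2] [mg g2]; split; first exact: measurable_funD.
apply: (@Rintegrable_eq _ (fun x => f x ^+ 2 + (2 * (f x * g x) + g x ^+ 2))) => //.
  by move=> x _; ring.
by apply: RintegrableD => //; apply: RintegrableD => //; exact: RintegrableZ.
Qed.

Lemma L2funZ D c f : measurable D -> L2fun D f -> L2fun D (fun x => c * f x).
Proof.
move=> mD [mf f2]; split; first exact: measurable_funM.
apply: Rintegrable_eq (RintegrableZ (c ^+ 2) mD f2) => //.
by move=> x _; rewrite exprMn.
Qed.

Lemma L2funS D E f : measurable D -> measurable E -> E `<=` D ->
  L2fun D f -> L2fun E f.
Proof.
move=> mD mE ED [mf f2]; split; first exact: measurable_funS mf.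
exact: integrableS f2.
Qed.

Lemma bounded_L2fun D f M : measurable D -> (mu D < +oo)%E ->
  measurable_fun D f -> (forall x, D x -> `|f x| <= M) -> L2fun D f.
Proof.
move=> mD Dfin mf fM; split=> //; apply: (@bounded_integrable _ _ (M ^+ 2)) => //.
  exact: measurable_funX.
by move=> x Dx; rewrite normrX ler_sqr ?nnegrE// ?fM// (le_trans _ (fM x Dx)).
Qed.

Lemma L2fun_integrable D f : measurable D -> (mu D < +oo)%E -> L2fun D f ->
  mu.-integrable D (EFin \o f).
Proof.
move=> mD Dfin Lf.
have L1 : L2fun D (cst 1).
  by apply: (@bounded_L2fun _ _ 1) => // x _; rewrite normr1.
apply: Rintegrable_eq (L2funM_integrable mD Lf L1) => //.
by move=> x _ /=; rewrite mulr1.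
Qed.

Definition sqnorm D f := \int[mu]_(x in D) (f x ^+ 2).

Lemma sqnorm_ge0 D f : 0 <= sqnorm D f.
Proof. by apply: Rintegral_ge0 => x _; exact: sqr_ge0. Qed.

(** Expanding the square; nonnegativity in [s] then yields Cauchy-Schwarz
    through [discriminant_le0], and equality cases yield first variations. *)
Lemma sqnormDZ D f g s : measurable D -> L2fun D f -> L2fun D g ->
  sqnorm D (fun x => s * f x + g x) =
  s ^+ 2 * sqnorm D f + 2 * s * (\int[mu]_(x in D) (f x * g x)) + sqnorm D g.
Proof.
move=> mD Lf Lg; have fg := L2funM_integrable mD Lf Lg.
case: Lf Lg => [_ f2] [_ g2].
have sf2 := RintegrableZ (s ^+ 2) mD f2.
have sfg := RintegrableZ (2 * s) mD fg.
rewrite /sqnorm -!RintegralZl// -!RintegralD//; last exact: RintegrableD.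
by apply: eq_Rintegral => x _; ring.
Qed.

Lemma discriminant_le0 (a b c : R) : 0 <= a ->
  (forall s, 0 <= s ^+ 2 * a + 2 * s * b + c) -> b ^+ 2 <= a * c.
Proof.
rewrite le_eqVlt => /predU1P[<-|a0] h.
  rewrite mul0r; have [->|b0] := eqVneq b 0; first by rewrite expr0n.
  (* the polynomial is affine, and takes the value -1 at this point *)
  have := h (- (c + 1) / (2 * b)).
  rewrite mulr0 add0r (_ : 2 * _ * b = - (c + 1)); last by field.
  by lra.
have := h (- b / a).
rewrite (_ : _ + _ = (a * c - b ^+ 2) / a); last by field; rewrite gt_eqF.
by rewrite pmulr_lge0 ?invr_gt0// subr_ge0.
Qed.

Lemma cauchy_schwarz_L2 D f g : measurable D -> L2fun D f -> L2fun D g ->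
  (\int[mu]_(x in D) (f x * g x)) ^+ 2 <= sqnorm D f * sqnorm D g.
Proof.
move=> mD Lf Lg; apply: discriminant_le0; first exact: sqnorm_ge0.
by move=> s; rewrite -sqnormDZ//; exact: sqnorm_ge0.
Qed.

Lemma le_pairing D f g a b : measurable D -> L2fun D f -> L2fun D g ->
  0 <= a -> 0 <= b -> sqnorm D f <= a ^+ 2 -> sqnorm D g <= b ^+ 2 ->
  `|\int[mu]_(x in D) (f x * g x)| <= a * b.
Proof.
move=> mD Lf Lg a0 b0 fa gb.
rewrite -ler_sqr ?nnegrE ?mulr_ge0// real_normK ?num_real// exprMn.
rewrite (le_trans (cauchy_schwarz_L2 mD Lf Lg))//.
by rewrite ler_pM// sqnorm_ge0.
Qed.

Lemma sqnormZ D c f : L2fun D f -> measurable D ->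
  sqnorm D (fun x => c * f x) = c ^+ 2 * sqnorm D f.
Proof.
move=> [_ f2] mD; rewrite /sqnorm -RintegralZl//.
by apply: eq_Rintegral => x _; rewrite exprMn.
Qed.

End SquareIntegrableReal.

(** * Real functions in H^1_0(0, L) *)

Lemma measurable_itv_oo (R : realType) (a b : R) : measurable (`]a, b[ : set R).
Proof. exact: measurable_itv. Qed.

Lemma itv_oo_measure_lty (R : realType) (a b : R) :
  (@lebesgue_measure R `]a, b[ < +oo)%E.
Proof.
by rewrite lebesgue_measure_itv/=; case: ifP => // _; rewrite -EFinB ltry.
Qed.

#[local] Hint Extern 0 (measurable _) => exact: measurable_itv_oo : core.
#[local] Hint Extern 0 (is_true (_ < +oo)%E) =>
  exact: itv_oo_measure_lty : core.

Section Sobolev.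
Variable R : realType.
Notation mu := (@lebesgue_measure R).
Implicit Types (a b c x L : R) (f g : R -> R).

Lemma fine_itv_oo a b : a <= b -> fine (mu `]a, b[) = b - a.
Proof.
rewrite lebesgue_measure_itv/= lte_fin; case: ltP => //= ba ab.
by apply/esym/eqP; rewrite subr_eq0 eq_le ba ab.
Qed.

Lemma subset_itv_oo a b c e : a <= c -> e <= b -> `]c, e[ `<=` (`]a, b[ : set R).
Proof. by move=> ac eb; apply: subset_itv; rewrite bnd_simp. Qed.

Lemma integrable_itv_cc a b f : mu.-integrable `]a, b[ (EFin \o f) ->
  mu.-integrable `[a, b] (EFin \o f).
Proof.
move=> /integrableP[/measurable_EFinP mf fi].
have mfc : measurable_fun `[a, b] f by exact: measurable_fun_itv_cc mf.
apply/integrableP; split; first exact/measurable_EFinP.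
rewrite -integral_itv_bndo_bndc; last first.
  apply: measurableT_comp => //; apply/measurable_EFinP.
  by apply/measurable_fun_itv_bndo_bndcP.
rewrite -integral_itv_obnd_cbnd//.
by apply: measurableT_comp => //; exact/measurable_EFinP.
Qed.

Lemma Rintegral_itv_oo_cc a b f : mu.-integrable `]a, b[ (EFin \o f) ->
  \int[mu]_(x in `[a, b]) f x = \int[mu]_(x in `]a, b[) f x.
Proof.
move=> fi; have fc := integrable_itv_cc fi.
rewrite -Rintegral_itv_bndo_bndc; last first.
  by apply: integrableS fc => //; exact: subset_itv_co_cc.
by rewrite -Rintegral_itv_obnd_cbnd.
Qed.

Lemma Rintegral_itv_split a b c f : a <= b -> b <= c ->
  mu.-integrable `]a, c[ (EFin \o f) ->
  \int[mu]_(x in `]a, c[) f x =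
  \int[mu]_(x in `]a, b[) f x + \int[mu]_(x in `]b, c[) f x.
Proof.
rewrite le_eqVlt => /predU1P[<- _ _|ab].
  by rewrite set_itvoo0 Rintegral_set0 add0r.
rewrite le_eqVlt => /predU1P[<- _|bc fi].
  by rewrite set_itvoo0 Rintegral_set0 addr0.
have := @Rintegral_itvB _ _ _ _ b fi; rewrite !bnd_simp => /(_ (ltW ab) bc) <-.
rewrite -(@Rintegral_itv_bndo_bndc _ _ b); first by rewrite subrKC.
by apply: integrableS fi => //; apply: subset_itv_oo => //; exact: ltW.
Qed.

(** Real counterpart of [H10]: a complex function is in [H10] if and only if
    its real and imaginary parts are in [sobolev0] (see [H10P]). *)
Definition sobolev0 L f f' :=
  [/\ L2fun `]0, L[ f',
      forall x, x \in `[0, L] -> f x = \int[mu]_(t in `[0, x]) f' t &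
      f L = 0].

Lemma sobolev0_L2 L f f' a b : sobolev0 L f f' -> 0 <= a -> b <= L ->
  L2fun `]a, b[ f'.
Proof. by move=> [Lf _ _] a0 bL; apply: L2funS Lf => //; exact: subset_itv_oo. Qed.

Lemma sobolev0_integrable L f f' a b : sobolev0 L f f' -> 0 <= a -> b <= L ->
  mu.-integrable `]a, b[ (EFin \o f').
Proof.
by move=> ff' a0 bL; apply: L2fun_integrable => //; exact: (sobolev0_L2 ff').
Qed.

Lemma sobolev0_increment L f f' a b : sobolev0 L f f' ->
  0 <= a -> a <= b -> b <= L -> f b - f a = \int[mu]_(t in `]a, b[) f' t.
Proof.
move=> ff' a0 ab bL; have [_ fE _] := ff'.
rewrite !fE ?in_itv/= ?a0 ?bL ?(le_trans a0)// ?(le_trans ab)//.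
rewrite !Rintegral_itv_oo_cc; last 2 first.
  by apply: sobolev0_integrable ff' _ _ => //; exact: le_trans ab bL.
  exact: sobolev0_integrable ff' _ _.
rewrite (Rintegral_itv_split a0 ab) 1?addrC ?addKr//.
exact: sobolev0_integrable ff' _ _.
Qed.

Lemma sobolev0_left L f f' : 0 <= L -> sobolev0 L f f' -> f 0 = 0.
Proof.
move=> L0 [_ fE _]; rewrite fE ?in_itv/= ?lexx//.
by rewrite set_itv1 Rintegral_set1.
Qed.

Lemma sqr_Rintegral_le a b g : a <= b -> L2fun `]a, b[ g ->
  (\int[mu]_(t in `]a, b[) g t) ^+ 2 <= (b - a) * sqnorm `]a, b[ g.
Proof.
move=> ab Lg.
have L1 : L2fun `]a, b[ (cst 1).
  by apply: (@bounded_L2fun _ _ _ 1) => // x _; rewrite normr1.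
have := cauchy_schwarz_L2 (measurable_itv_oo a b) L1 Lg.
rewrite (_ : sqnorm _ (cst 1) = b - a); last first.
  rewrite /sqnorm -[RHS]mul1r -(fine_itv_oo ab) -Rintegral_cst//.
  by apply: eq_Rintegral => x _; rewrite expr1n.
by congr (_ ^+ 2 <= _); apply: eq_Rintegral => x _; rewrite mul1r.
Qed.

Lemma sqnorm_subitv a b c e g : a <= c -> c <= e -> e <= b -> L2fun `]a, b[ g ->
  sqnorm `]c, e[ g <= sqnorm `]a, b[ g.
Proof.
move=> ac ce eb [_ g2]; rewrite /sqnorm.
rewrite (@Rintegral_itv_split a c b)//; last exact: le_trans eb.
rewrite (@Rintegral_itv_split c e b)//; last first.
  by apply: integrableS g2 => //; exact: subset_itv_oo.
have := sqnorm_ge0 `]a, c[ g; have := sqnorm_ge0 `]e, b[ g.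
by rewrite /sqnorm; lra.
Qed.

(** Cauchy-Schwarz against the constant 1 on the interval between the two points;
    the bound is then enlarged to a common interval [a, b]. *)
Lemma sobolev0_sqr_increment L f f' a b x y : sobolev0 L f f' ->
  0 <= a -> b <= L -> x \in `[a, b] -> y \in `[a, b] ->
  (f x - f y) ^+ 2 <= (b - a) * sqnorm `]a, b[ f'.
Proof.
move=> ff' a0 bL; wlog xy : x y / x <= y.
  move=> h xab yab; have [xy|/ltW yx] := leP x y; first exact: h.
  by rewrite -sqrrN opprB; apply: h.
rewrite !in_itv/= => /andP[ax xb] /andP[ay yb].
rewrite -sqrrN opprB (@sobolev0_increment L f f')//; last 2 first.
  exact: le_trans ax.
  exact: le_trans bL.
have Lf : L2fun `]a, b[ f' by exact: sobolev0_L2 ff' _ _.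
apply: le_trans (sqr_Rintegral_le xy _) _.
  by apply: L2funS Lf => //; exact: subset_itv_oo.
apply: ler_pM; rewrite ?subr_ge0 ?sqnorm_ge0 ?sqnorm_subitv//.
by rewrite lerB.
Qed.

Lemma sobolev0_sqr_le L f f' x : sobolev0 L f f' -> x \in `[0, L] ->
  f x ^+ 2 <= L * sqnorm `]0, L[ f'.
Proof.
move=> ff' xL; have L0 : 0 <= L by move: xL; rewrite in_itv => /andP[]; exact: le_trans.
have := @sobolev0_sqr_increment L f f' 0 L x 0 ff' (lexx _) (lexx _) xL.
rewrite (sobolev0_left L0 ff') !subr0; apply.
by rewrite in_itv/= lexx.
Qed.

Lemma sobolev0_norm_le L f f' x s : sobolev0 L f f' -> x \in `[0, L] ->
  0 <= s -> sqnorm `]0, L[ f' <= s ^+ 2 -> `|f x| <= Num.sqrt L * s.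
Proof.
move=> ff' xL s0 fs.
have L0 : 0 <= L by move: xL; rewrite in_itv => /andP[]; exact: le_trans.
rewrite -ler_sqr ?nnegrE ?mulr_ge0 ?sqrtr_ge0// real_normK ?num_real//.
rewrite exprMn sqr_sqrtr// (le_trans (sobolev0_sqr_le ff' xL))//.
exact: ler_wpM2l.
Qed.

Lemma sobolev0_measurable L f f' : 0 <= L -> sobolev0 L f f' ->
  measurable_fun `]0, L[ f.
Proof.
move=> L0 ff'; have [_ fE _] := ff'.
have fi : mu.-integrable `[0, L] (EFin \o f').
  by apply: integrable_itv_cc; exact: sobolev0_integrable ff' _ _.
have mF : measurable_fun `[0, L]
    (fun x => \int[mu]_(t in `[0, x]) f' t).
  apply: (@subspace_continuous_measurable_fun _ `[0, L]) => //.
  exact: parameterized_integral_continuous.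
apply: (@measurable_funS _ _ _ _ `[0, L]) => //; first exact: subset_itv_oo_cc.
by apply: eq_measurable_fun mF => x; rewrite inE/= => xL; rewrite fE.
Qed.

Lemma sobolev0_L2fun L f f' : 0 <= L -> sobolev0 L f f' -> L2fun `]0, L[ f.
Proof.
move=> L0 ff'.
apply: (@bounded_L2fun _ _ _ (Num.sqrt L * Num.sqrt (sqnorm `]0, L[ f'))) => //.
  exact: sobolev0_measurable ff'.
move=> x /= xL; apply: (sobolev0_norm_le ff') => //.
  by apply: subset_itv_oo_cc.
by rewrite sqr_sqrtr// sqnorm_ge0.
Qed.

Lemma sobolev0D L f f' g g' : sobolev0 L f f' -> sobolev0 L g g' ->
  sobolev0 L (fun x => f x + g x) (fun x => f' x + g' x).
Proof.
move=> ff' gg'; have [Lf fE fL] := ff'; have [Lg gE gL] := gg'.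
split; [exact: L2funD| |by rewrite fL gL addr0].
move=> x xL; rewrite fE// gE// RintegralD//; apply: integrable_itv_cc.
  by apply: sobolev0_integrable ff' _ _ => //; move: xL; rewrite in_itv => /andP[].
by apply: sobolev0_integrable gg' _ _ => //; move: xL; rewrite in_itv => /andP[].
Qed.

Lemma sobolev0Z L c f f' : sobolev0 L f f' ->
  sobolev0 L (fun x => c * f x) (fun x => c * f' x).
Proof.
move=> ff'; have [Lf fE fL] := ff'.
split; [exact: L2funZ| |by rewrite fL mulr0].
move=> x xL; rewrite fE// RintegralZl//; apply: integrable_itv_cc.
by apply: sobolev0_integrable ff' _ _ => //; move: xL; rewrite in_itv => /andP[].
Qed.

End Sobolev.

(** * A Schur test *)

Section SchurTest.
Variable R : realType.
Notation mu := (@lebesgue_measure R).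
Implicit Types (A : set R) (g h s w : R -> R) (K : R -> R -> bool).
Local Open Scope ereal_scope.

(** Tonelli's theorem for the function equal to [s x * h y] where [K x y] holds
    and to 0 elsewhere: the first hypothesis bounds [g x ^+ 2] by its integral
    in [y], the second one says that its integral in [x] is at most [w y * h y]. *)
Lemma schur_test A K g h s w : measurable A ->
  measurable_fun setT (fun z : R * R => K z.1 z.2) ->
  measurable_fun A g -> measurable_fun A s -> measurable_fun A h ->
  measurable_fun A w ->
  (forall x, A x -> (0 <= s x)%R) -> (forall x, A x -> (0 <= h x)%R) ->
  (forall x, A x -> ((g x) ^+ 2)%:E <=
     \int[mu]_(y in A `&` [set y | K x y]) (s x * h y)%:E) ->
  (forall y, A y -> \int[mu]_(x in A `&` [set x | K x y]) (s x)%:E <= (w y)%:E) ->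
  \int[mu]_(x in A) ((g x) ^+ 2)%:E <= \int[mu]_(y in A) (w y * h y)%:E.
Proof.
move=> mA mK mg ms mh mw s0 h0 gle wle.
pose sA := s \_ A; pose hA := h \_ A.
have sA0 x : (0 <= sA x)%R.
  by rewrite /sA patchE; case: ifPn => [/set_mem/s0|].
have hA0 x : (0 <= hA x)%R.
  by rewrite /hA patchE; case: ifPn => [/set_mem/h0|].
have msA : measurable_fun setT sA by exact: (measurable_restrictT s mA).1.
have mhA : measurable_fun setT hA by exact: (measurable_restrictT h mA).1.
pose F (z : R * R) := (if K z.1 z.2 then sA z.1 * hA z.2 else 0)%R%:E.
have F0 z : 0 <= F z.
  by rewrite /F lee_fin; case: ifP => // _; exact: mulr_ge0.
have mF : measurable_fun setT F.
  apply/measurable_EFinP; apply: measurable_fun_ifT => //.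
  by apply: measurable_funM; exact: measurableT_comp.
have mF1 : measurable_fun [set: R] (fun x => \int[mu]_y F (x, y)).
  exact: (@measurable_fun_fubini_tonelli_F _ _ _ _ R mu F mF F0).
have mF2 : measurable_fun [set: R] (fun y => \int[mu]_x F (x, y)).
  exact: (@measurable_fun_fubini_tonelli_G _ _ _ _ R mu F mF F0).
have sectx x : A x -> \int[mu]_y F (x, y) =
    \int[mu]_(y in A `&` [set y | K x y]) (s x * h y)%:E.
  move=> Ax; rewrite [RHS]integral_mkcond; apply: eq_integral => y _.
  rewrite /F /= /sA /hA !patchE (mem_set Ax) in_setI.
  rewrite (_ : (y \in [set y | K x y]) = K x y); last first.
    by apply/idP/idP; rewrite inE.
  by case: (y \in A); case: (K x y) => //=; rewrite mulr0.
have secty y : A y -> \int[mu]_x F (x, y) =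
    (h y)%:E * \int[mu]_(x in A `&` [set x | K x y]) (s x)%:E.
  move=> Ay; have mAK : measurable (A `&` [set x | K x y]).
    have := measurableT_comp mK (@measurable_pair2 _ _ R R y).
    move=> /(_ measurableT [set true] Logic.I); rewrite setTI => mKy.
    exact: measurableI.
  rewrite -ge0_integralZl//; last 3 first.
    by apply/measurable_EFinP; apply: measurable_funS ms => //; exact: subIsetl.
    by move=> x [Ax _]; rewrite lee_fin s0.
    by rewrite lee_fin h0.
  rewrite [RHS]integral_mkcond; apply: eq_integral => x _.
  rewrite /F /= /sA /hA !patchE (mem_set Ay) in_setI.
  rewrite (_ : (x \in [set x | K x y]) = K x y); last first.
    by apply/idP/idP; rewrite inE.
  by case: (x \in A); case: (K x y) => //=; rewrite ?mul0r// -EFinM mulrC.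
apply: (@le_trans _ _ (\int[mu]_(x in A) \int[mu]_y F (x, y))).
  apply: ge0_le_integral => //.
  - by move=> x _; rewrite lee_fin sqr_ge0.
  - by apply/measurable_EFinP; exact: measurable_funX.
  - exact: (@measurable_funS _ _ _ _ setT).
  - by move=> x Ax; rewrite sectx//; exact: gle.
apply: (@le_trans _ _ (\int[mu]_x \int[mu]_y F (x, y))).
  apply: ge0_subset_integral => //.
  - by move=> x _; exact: integral_ge0.
rewrite (@fubini_tonelli _ _ _ _ R mu mu F)// [leRHS]integral_mkcond.
apply: ge0_le_integral => //.
- by move=> y _; exact: integral_ge0.
- apply: (measurable_restrictT _ mA).1; apply/measurable_EFinP.
  exact: measurable_funM.
move=> y _; rewrite patchE; case: ifPn => [/set_mem Ay|Ay].
  rewrite secty// mulrC EFinM; apply: lee_wpmul2l; first by rewrite lee_fin h0.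
  exact: wle.
rewrite integral0_eq// => x _; rewrite /F /hA /= patchE (negbTE Ay) mulr0.
by case: ifP.
Qed.

End SchurTest.

(** * The sharp Poincare inequality and the first Dirichlet mode *)

Section Wirtinger.
Variable R : realType.
Notation mu := (@lebesgue_measure R).
Implicit Types (a b c k x y L : R) (f g F w : R -> R).

Lemma FTC_oo F f a b : (forall x, is_derive x 1 F (f x)) -> continuous f ->
  a <= b -> (\int[mu]_(x in `]a, b[) (f x)%:E)%E = (F b - F a)%:E.
Proof.
move=> dF cf; rewrite le_eqVlt => /predU1P[<-|ab].
  by rewrite set_itvoo0 integral_set0 subrr.
have mf : measurable_fun setT f by exact: continuous_measurable_fun.
have cF : continuous F.
  by move=> x; apply: differentiable_continuous; apply/derivable1_diffP;
     case: (dF x).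
rewrite integral_itv_obnd_cbnd; last first.
  by apply/measurable_EFinP; exact: measurable_funS mf.
rewrite integral_itv_bndo_bndc; last first.
  by apply/measurable_EFinP; exact: measurable_funS mf.
rewrite (@continuous_FTC2 _ f F)// ?EFinB//.
- exact: continuous_subspaceT.
- split; first by move=> x _; case: (dF x).
  + by apply: cvg_at_right_filter; exact: cF.
  + by apply: cvg_at_left_filter; exact: cF.
- by move=> x _; rewrite derive1E; apply: derive_val.
Qed.

Lemma FTC_oo_Rintegral F f a b : (forall x, is_derive x 1 F (f x)) ->
  continuous f -> a <= b -> \int[mu]_(x in `]a, b[) f x = F b - F a.
Proof. by move=> dF cf ab; rewrite /Rintegral (FTC_oo dF cf ab). Qed.

Lemma is_derive_sinZ k x : is_derive x 1 (fun x => sin (k * x)) (k * cos (k * x)).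
Proof.
have h : is_derive x 1 (fun x => k * x) k.
  by apply: is_derive_eq; exact: mulr1.
have := @is_derive1_comp _ sin (fun x => k * x) x _ _ (is_derive_sin (k * x)) h.
by rewrite mulrC.
Qed.

Lemma is_derive_cosZ k x : is_derive x 1 (fun x => cos (k * x)) (- k * sin (k * x)).
Proof.
have h : is_derive x 1 (fun x => k * x) k.
  by apply: is_derive_eq; exact: mulr1.
have := @is_derive1_comp _ cos (fun x => k * x) x _ _ (is_derive_cos (k * x)) h.
by rewrite mulrC mulrN mulNr.
Qed.

Lemma continuous_sinZ k : continuous (fun x : R => sin (k * x)).
Proof.
by move=> x; apply: differentiable_continuous; apply/derivable1_diffP;
   case: (is_derive_sinZ k x).
Qed.

Lemma continuous_cosZ k : continuous (fun x : R => cos (k * x)).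
Proof.
by move=> x; apply: differentiable_continuous; apply/derivable1_diffP;
   case: (is_derive_cosZ k x).
Qed.

Lemma continuousZ_fun c f : continuous f -> continuous (fun x => c * f x).
Proof. by move=> cf x; apply: continuousM; [exact: cst_continuous|exact: cf]. Qed.

(** Cauchy-Schwarz for the factorization of [g] into [sqrt w] and [g / sqrt w],
    obtained without square roots from [0 <= (s w + g)^2 / w] for all [s]. *)
Lemma cauchy_schwarz_weighted (D : set R) g w : measurable D ->
  mu.-integrable D (EFin \o g) -> mu.-integrable D (EFin \o w) ->
  mu.-integrable D (EFin \o (fun x => g x ^+ 2 / w x)) ->
  (forall x, D x -> 0 < w x) ->
  (\int[mu]_(x in D) g x) ^+ 2 <=
  (\int[mu]_(x in D) w x) * \int[mu]_(x in D) (g x ^+ 2 / w x).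
Proof.
move=> mD gi wi gwi w0; apply: discriminant_le0.
  by apply: Rintegral_ge0 => x Dx; exact/ltW/w0.
move=> s; have i1 := RintegrableZ (s ^+ 2) mD wi.
have i2 := RintegrableZ (2 * s) mD gi.
rewrite -!RintegralZl// -!RintegralD//; last exact: RintegrableD.
apply: Rintegral_ge0 => x Dx; have wx := w0 x Dx.
have wx0 : w x != 0 by rewrite gt_eqF.
rewrite (_ : _ + _ = (s * w x + g x) ^+ 2 / w x); last by field.
by rewrite divr_ge0 ?sqr_ge0// ltW.
Qed.

(** The weight of [schur_wirtinger] vanishes at one end of the interval, but
    not on the subintervals where the weighted Cauchy-Schwarz inequality is used. *)
Lemma sqr_div_weight_integrable a b m g w : L2fun `]a, b[ g ->
  continuous w -> 0 < m -> (forall x, x \in `]a, b[ -> m <= w x) ->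
  mu.-integrable `]a, b[ (EFin \o (fun x => g x ^+ 2 / w x)).
Proof.
move=> [mg g2] cw m0 mlew.
have wi : measurable_fun `]a, b[ (fun x => (w x)^-1).
  apply: open_continuous_measurable_fun; first exact: interval_open.
  move=> x; rewrite inE/= => xab; apply: cvgV; last exact: cw.
  by rewrite gt_eqF// (lt_le_trans m0)// mlew.
apply: (@le_integrable _ _ _ mu _ _ _ _ _ _ (RintegrableZ m^-1 _ g2)) => //.
  by apply/measurable_EFinP; apply: measurable_funM => //; exact: measurable_funX.
move=> x /= xab; rewrite lee_fin !normrM [leLHS]mulrC ler_wpM2r//.
have wx := mlew x xab.
rewrite !gtr0_norm ?invr_gt0//; last exact: lt_le_trans wx.
by rewrite lef_pV2// posrE (lt_le_trans m0).
Qed.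

Lemma measurable_weight a b w : continuous w -> measurable_fun `]a, b[ w.
Proof.
move=> cw; apply: (@measurable_funS _ _ _ _ setT) => //.
exact: continuous_measurable_fun.
Qed.

Lemma continuous_itv_integrable a b w : continuous w ->
  mu.-integrable `]a, b[ (EFin \o w).
Proof.
move=> cw; apply: (@integrableS _ _ _ mu `[a, b]) => //.
  exact: subset_itv_oo_cc.
apply: continuous_compact_integrable; first exact: segment_compact.
exact: continuous_subspaceT.
Qed.

(** Common core of the left and right half-interval estimates.  In both uses
    ]c, e[ lies between [x] and the end where [g] vanishes.  The last hypothesis
    is what makes [w] the optimal weight: integrating [k ^+ 2 * S] on
    the other side of [y] gives [w y] back. *)
Lemma schur_wirtinger a b k (K : R -> R -> bool) (S w g g' : R -> R) :
  measurable_fun setT (fun z : R * R => K z.1 z.2) ->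
  continuous S -> continuous w ->
  (forall x, x \in `]a, b[ -> 0 < w x) -> (forall x, x \in `]a, b[ -> 0 <= S x) ->
  measurable_fun `]a, b[ g -> L2fun `]a, b[ g' ->
  (forall x, x \in `]a, b[ -> exists c e : R,
     [/\ `]a, b[ `&` [set y | K x y] = `]c, e[%classic,
         forall y, y \in `]c, e[ -> w x <= w y,
         \int[mu]_(y in `]c, e[) w y = S x &
         g x ^+ 2 = (\int[mu]_(y in `]c, e[) g' y) ^+ 2]) ->
  (forall y, y \in `]a, b[ ->
     (\int[mu]_(x in `]a, b[ `&` [set x | K x y]) (k ^+ 2 * S x)%:E = (w y)%:E)%E) ->
  k ^+ 2 * sqnorm `]a, b[ g <= sqnorm `]a, b[ g'.
Proof.
move=> mK cS cw w0 S0 mg Lg' sect adj.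
pose h x := g' x ^+ 2 / w x.
have wV : measurable_fun `]a, b[ (fun x => (w x)^-1).
  apply: open_continuous_measurable_fun; first exact: interval_open.
  move=> x; rewrite inE/= => xac; apply: cvgV; last exact: cw.
  by rewrite gt_eqF// w0.
have [mg' g'2] := Lg'.
have mh : measurable_fun `]a, b[ h.
  by apply: measurable_funM => //; exact: measurable_funX.
have mS := @measurable_weight a b _ (@continuousZ_fun (k ^+ 2) _ cS).
have mw := @measurable_weight a b _ cw.
have h0 x : x \in `]a, b[ -> 0 <= h x.
  by move=> xab; rewrite divr_ge0 ?sqr_ge0// ltW// w0.
have main : (\int[mu]_(x in `]a, b[) ((k * g x) ^+ 2)%:E <=
             \int[mu]_(x in `]a, b[) (w x * h x)%:E)%E.
  apply: (@schur_test _ `]a, b[ K _ h (fun x => k ^+ 2 * S x)) => //.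
  - exact: measurable_funM.
  - by move=> x /S0 Sx; rewrite mulr_ge0// sqr_ge0.
  - move=> x /= xab; have [c [e [IE wle wS gE]]] := sect x xab.
    have sub : `]c, e[%classic `<=` `]a, b[%classic by rewrite -IE; exact: subIsetl.
    have Lce : L2fun `]c, e[ g' by exact: L2funS Lg'.
    have hi : mu.-integrable `]c, e[ (EFin \o h).
      by apply: (sqr_div_weight_integrable (m := w x)) => //; exact: w0.
    have wi := @continuous_itv_integrable c e _ cw.
    have := @cauchy_schwarz_weighted _ _ _ _ (L2fun_integrable _ _ Lce) wi hi.
    rewrite wS -gE => cs.
    have -> : (\int[mu]_(y in `]a, b[ `&` [set y | K x y]) (k ^+ 2 * S x * h y)%:E =
        (k ^+ 2 * S x * \int[mu]_(y in `]c, e[) h y)%:E)%E.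
      rewrite IE -RintegralZl// /Rintegral fineK//.
      by apply: integrable_fin_num => //; exact: RintegrableZ.
    rewrite lee_fin exprMn -mulrA ler_wpM2l ?sqr_ge0//; apply: cs => //.
    by move=> y /sub/w0.
  - by move=> y /adj ->.
have L0 : 0 <= sqnorm `]a, b[ g' by exact: sqnorm_ge0.
have rhs : (\int[mu]_(x in `]a, b[) (w x * h x)%:E = (sqnorm `]a, b[ g')%:E)%E.
  rewrite /sqnorm /Rintegral fineK; last exact: integrable_fin_num.
  apply: eq_integral => x; rewrite inE/= => /w0 wx.
  by rewrite /h mulrC divfK// gt_eqF.
rewrite rhs in main.
have kg2 : mu.-integrable `]a, b[ (EFin \o (fun x => (k * g x) ^+ 2)).
  apply/integrableP; split.
    apply/measurable_EFinP; apply: measurable_funX; exact: measurable_funM.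
  under eq_integral do rewrite /= ger0_norm ?sqr_ge0//.
  exact: le_lt_trans main (ltry _).
have [k0|k0] := eqVneq k 0; first by rewrite k0 expr0n mul0r.
have g2 : L2fun `]a, b[ g.
  split=> //; apply: Rintegrable_eq (RintegrableZ (k ^- 2) _ kg2) => //.
  by move=> x _; rewrite exprMn mulKf// expf_neq0.
rewrite -sqnormZ// -lee_fin /sqnorm /Rintegral fineK//.
exact: integrable_fin_num.
Qed.

Section FirstMode.
Variable L : R.
Hypothesis L0 : 0 < L.
Let k : R := pi / L.
Let c : R := L / 2.

Let k0 : 0 < k. Proof. by rewrite divr_gt0// pi_gt0. Qed.
Let kL : k * L = pi. Proof. by rewrite /k divfK// gt_eqF. Qed.
Let kc : k * c = pi / 2. Proof. by rewrite /c mulrA kL. Qed.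

Let c0 : 0 <= c. Proof. by rewrite divr_ge0// ltW. Qed.
Let cL : c <= L. Proof. by rewrite /c ler_pdivrMr// ler_pMr// ler1n. Qed.

Lemma sin_mode_ge0 x : x \in `[0, L] -> 0 <= sin (k * x).
Proof.
rewrite in_itv/= => /andP[x0 xL]; apply: sin_ge0_pi.
by rewrite mulr_ge0 ?(ltW k0)//= -kL ler_wpM2l// ltW.
Qed.

Lemma is_derive_primitive x : is_derive x 1 (fun x => k^-1 * sin (k * x)) (cos (k * x)).
Proof.
have -> : cos (k * x) = k^-1 * (k * cos (k * x)) by rewrite mulKf// gt_eqF.
by apply: (is_deriveZ k^-1); exact: is_derive_sinZ.
Qed.

Lemma cos_mode_le x y : 0 <= x -> x <= y -> y <= L -> cos (k * y) <= cos (k * x).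
Proof.
move=> x0 xy yL; have kx : k * x <= k * y by rewrite ler_wpM2l// ltW.
have ky : k * y <= pi by rewrite -kL ler_wpM2l// ltW.
have [->//|ne] := eqVneq (k * x) (k * y).
have kx0 : 0 <= k * x by rewrite mulr_ge0// ltW.
apply: ltW; rewrite ltr_cos ?in_itv/= ?lt_neqAle ?ne ?kx0//=.
- exact: le_trans ky.
- by rewrite (le_trans kx0).
Qed.

Lemma cos_mode_gt0 x : x \in `]0, c[ -> 0 < cos (k * x).
Proof.
rewrite in_itv/= => /andP[x0 xc]; apply: cos_gt0_pihalf.
have p0 : 0 < pi / 2 :> R by rewrite divr_gt0// pi_gt0.
have kx0 : 0 < k * x by rewrite mulr_gt0.
apply/andP; split; last by rewrite -kc ltr_pM2l.
by apply: lt_trans kx0; rewrite oppr_lt0.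
Qed.

Lemma cos_mode_lt0 x : x \in `]c, L[ -> cos (k * x) < 0.
Proof.
rewrite in_itv/= => /andP[cx xL].
have xE : k * x = k * (x - c) + pi / 2 by rewrite -kc -mulrDr subrK.
rewrite xE cosDpihalf oppr_lt0; apply: sin_gt0_pi.
rewrite mulr_gt0 ?subr_gt0//= -kL ltr_pM2l// ltrBlDr.
by apply: (lt_le_trans xL); rewrite lerDl.
Qed.

Lemma integral_primitive s x y : x <= y ->
  \int[mu]_(t in `]x, y[) (s * cos (k * t)) =
  s * (k^-1 * sin (k * y)) - s * (k^-1 * sin (k * x)).
Proof.
move=> xy; apply: (@FTC_oo_Rintegral (fun x => s * (k^-1 * sin (k * x)))
  (fun x => s * cos (k * x))) => //.
  by move=> t; apply: (is_deriveZ s); exact: is_derive_primitive.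
exact: (continuousZ_fun (@continuous_cosZ _)).
Qed.

Lemma integral_sin_mode x y : x <= y ->
  (\int[mu]_(t in `]x, y[) (k ^+ 2 * (k^-1 * sin (k * t)))%:E)%E =
  (cos (k * x) - cos (k * y))%:E.
Proof.
move=> xy; rewrite (_ : _ - _ = (- 1 * cos (k * y)) - (- 1 * cos (k * x)));
  last by ring.
apply: (@FTC_oo (fun x => - 1 * cos (k * x))
  (fun x => k ^+ 2 * (k^-1 * sin (k * x)))) => //; last first.
  exact: (continuousZ_fun (continuousZ_fun (@continuous_sinZ _))).
move=> t; have -> : k ^+ 2 * (k^-1 * sin (k * t)) = - 1 * (- k * sin (k * t)).
  by field; rewrite gt_eqF.
by apply: (is_deriveZ (-1)); exact: is_derive_cosZ.
Qed.

(** The weight is the absolute value of [cos (k * x)], that is [cos] on the left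
    half and [- cos] on the right half: [g] is controlled from the endpoint 0 on
    the former, and from the endpoint [L] on the latter. *)
Lemma wirtinger g g' : sobolev0 L g g' ->
  k ^+ 2 * sqnorm `]0, L[ g <= sqnorm `]0, L[ g'.
Proof.
move=> gg'; have [_ gE gL] := gg'.
have mg : measurable_fun `]0, L[ g by exact: (sobolev0_measurable (ltW L0) gg').
have L2g := sobolev0_L2fun (ltW L0) gg'.
have Lg' : L2fun `]0, L[ g' by case: gg'.
have cS : continuous (fun x : R => k^-1 * sin (k * x)).
  exact: (continuousZ_fun (@continuous_sinZ _)).
have S0 x : x \in `[0, L] -> 0 <= k^-1 * sin (k * x).
  by move=> /sin_mode_ge0 ?; rewrite mulr_ge0// invr_ge0 ltW.
have left_half : k ^+ 2 * sqnorm `]0, c[ g <= sqnorm `]0, c[ g'.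
  apply: (@schur_wirtinger 0 c k (fun x y => y < x)
    (fun x => k^-1 * sin (k * x)) (fun x => 1 * cos (k * x))) => //.
  - exact: measurable_fun_ltr.
  - exact: (continuousZ_fun (@continuous_cosZ _)).
  - by move=> x xc; rewrite mul1r cos_mode_gt0.
  - move=> x; rewrite in_itv/= => /andP[x0 xc]; apply: S0.
    by rewrite in_itv/= (ltW x0)/= (le_trans (ltW xc)).
  - by apply: measurable_funS mg => //; exact: subset_itv_oo.
  - exact: sobolev0_L2 gg' _ _.
  - move=> x; rewrite in_itv/= => /andP[x0 xc]; exists 0, x; split.
    + apply/seteqP; split=> y /=; rewrite !in_itv/=; first by move=> [/andP[-> _]].
      by move=> /andP[-> yx]; rewrite (lt_trans yx).
    + move=> y; rewrite in_itv/= => /andP[y0 yx]; rewrite !mul1r.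
      apply: cos_mode_le; rewrite ?(ltW y0) ?(ltW yx)//.
      by rewrite (le_trans (ltW xc)).
    + by rewrite integral_primitive ?(ltW x0)// mulr0 sin0 mulr0 mulr0 subr0 mul1r.
    + rewrite -(@sobolev0_increment _ L g g')// ?(ltW x0)//.
        by rewrite (sobolev0_left _ gg') ?subr0// ltW.
      by rewrite (le_trans (ltW xc)).
  - move=> y; rewrite in_itv/= => /andP[y0 yc].
    have -> : `]0, c[ `&` [set x | y < x] = `]y, c[%classic.
      apply/seteqP; split=> x /=; rewrite !in_itv/=; first by move=> [/andP[_ ->] ->].
      by move=> /andP[yx ->]; rewrite yx (lt_trans y0).
    by rewrite integral_sin_mode ?(ltW yc)// kc cos_pihalf subr0 mul1r.
have right_half : k ^+ 2 * sqnorm `]c, L[ g <= sqnorm `]c, L[ g'.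
  apply: (@schur_wirtinger c L k (fun x y => x < y)
    (fun x => k^-1 * sin (k * x)) (fun x => - 1 * cos (k * x))) => //.
  - exact: measurable_fun_ltr.
  - exact: (continuousZ_fun (@continuous_cosZ _)).
  - by move=> x xc; rewrite mulN1r oppr_gt0 cos_mode_lt0.
  - move=> x; rewrite in_itv/= => /andP[xc xL]; apply: S0.
    by rewrite in_itv/= (ltW xL) andbT (le_trans _ (ltW xc)).
  - by apply: measurable_funS mg => //; exact: subset_itv_oo.
  - exact: sobolev0_L2 gg' _ _.
  - move=> x; rewrite in_itv/= => /andP[xc xL].
    have x0 : 0 <= x by rewrite (le_trans _ (ltW xc)).
    exists x, L; split.
    + apply/seteqP; split=> y /=; rewrite !in_itv/=; first by move=> [/andP[_ ->] ->].
      by move=> /andP[xy ->]; rewrite xy (lt_trans xc).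
    + move=> y; rewrite in_itv/= => /andP[xy yL]; rewrite !mulN1r lerN2.
      by apply: cos_mode_le; rewrite ?(ltW xy) ?(ltW yL).
    + rewrite integral_primitive ?(ltW xL)// kL sinpi mulr0 mulr0 sub0r.
      by rewrite mulN1r opprK.
    + rewrite -(@sobolev0_increment _ L g g')// ?(ltW xL)//.
      by rewrite gL sub0r sqrrN.
  - move=> y; rewrite in_itv/= => /andP[cy yL].
    have -> : `]c, L[ `&` [set x | x < y] = `]c, y[%classic.
      apply/seteqP; split=> x /=; rewrite !in_itv/=; first by move=> [/andP[-> _]].
      by move=> /andP[-> xy]; rewrite (lt_trans xy).
    by rewrite integral_sin_mode ?(ltW cy)// kc cos_pihalf sub0r mulN1r.
rewrite /sqnorm (Rintegral_itv_split c0 cL); last by case: L2g.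
rewrite (Rintegral_itv_split c0 cL (f := fun x => g' x ^+ 2)); last by case: Lg'.
by rewrite mulrDr lerD.
Qed.

Lemma sobolev0_sin : sobolev0 L (fun x => sin (k * x)) (fun x => k * cos (k * x)).
Proof.
have cc := @continuousZ_fun k _ (@continuous_cosZ k).
split.
- apply: (@bounded_L2fun _ _ _ k) => //; first exact: measurable_weight.
  move=> x _; rewrite normrM (ger0_norm (ltW k0)) ler_piMr ?(ltW k0)//.
  exact: cos_max.
- move=> x; rewrite in_itv/= => /andP[x0 xL].
  rewrite Rintegral_itv_oo_cc; last exact: continuous_itv_integrable.
  rewrite (FTC_oo_Rintegral (is_derive_sinZ k))//.
  by rewrite mulr0 sin0 subr0.
- by rewrite kL sinpi.
Qed.

(** Equality case of [wirtinger], because [k ^+ 2 * (cos ^+ 2 - sin ^+ 2)] is the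
    derivative of [k * (sin * cos)], which vanishes at both ends. *)
Lemma sqnorm_sin_mode :
  sqnorm `]0, L[ (fun x => k * cos (k * x)) =
  k ^+ 2 * sqnorm `]0, L[ (fun x => sin (k * x)).
Proof.
have [Lc _ _] := sobolev0_sin.
have Ls := sobolev0_L2fun (ltW L0) sobolev0_sin.
apply/eqP; rewrite -subr_eq0 -sqnormZ//; apply/eqP.
have Lks := L2funZ k (measurable_itv_oo 0 L) Ls.
rewrite /sqnorm -RintegralB//; [|by case: Lc|by case: Lks].
have dF x : is_derive x 1 (fun x => k * (sin (k * x) * cos (k * x)))
    ((k * cos (k * x)) ^+ 2 - (k * sin (k * x)) ^+ 2).
  have ds := is_derive_sinZ k x; have dc := is_derive_cosZ k x.
  apply: is_derive_eq (is_deriveZ k (is_deriveM ds dc)) _.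
  by rewrite /GRing.scale/=; ring.
have cf : continuous
    (fun x : R => (k * cos (k * x)) ^+ 2 - (k * sin (k * x)) ^+ 2).
  have cs := @continuousZ_fun k _ (@continuous_sinZ k).
  have cc := @continuousZ_fun k _ (@continuous_cosZ k).
  have sqr (h : R -> R) : continuous h -> continuous (fun x => h x ^+ 2).
    by move=> ch x; apply: (cvg_comp h (@GRing.exp R ^~ 2)); [exact: ch|
       exact: exprn_continuous].
  by move=> x; apply: cvgB; [exact: (sqr _ cc)|exact: (sqr _ cs)].
rewrite (FTC_oo_Rintegral dF cf (ltW L0)).
by rewrite kL sinpi mulr0 sin0 !mul0r !mulr0 subrr.
Qed.

(** The form [sqnorm g' - k ^+ 2 * sqnorm g] is nonnegative by [wirtinger] and
    vanishes at the sine.  Along [s * sin + g] it is therefore a polynomial in [s]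
    without quadratic term that stays nonnegative, so its linear coefficient is 0. *)
Lemma weak_sin_mode g g' : sobolev0 L g g' ->
  \int[mu]_(x in `]0, L[) (k * cos (k * x) * g' x) =
  k ^+ 2 * \int[mu]_(x in `]0, L[) (sin (k * x) * g x).
Proof.
move=> gg'; have ss' := sobolev0_sin.
have [Lg' _ _] := gg'; have [Ls' _ _] := ss'.
have Lg := sobolev0_L2fun (ltW L0) gg'.
have Ls := sobolev0_L2fun (ltW L0) ss'.
set B' := \int[mu]_(x in _) _; set B := \int[mu]_(x in _) _.
have h s : 0 <= s ^+ 2 * 0 + 2 * s * (B' - k ^+ 2 * B) +
    (sqnorm `]0, L[ g' - k ^+ 2 * sqnorm `]0, L[ g).
  have := wirtinger (sobolev0D (sobolev0Z s ss') gg').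
  rewrite !sqnormDZ// sqnorm_sin_mode -/B -/B' => ?; nra.
have := discriminant_le0 (lexx 0) h; rewrite mul0r.
by rewrite real_exprn_even_le0 ?num_real//= => /eqP/subr0_eq.
Qed.

End FirstMode.

End Wirtinger.

(** * Sampling at one point per cell *)

Section NodalSampling.
Variable R : realType.
Notation mu := (@lebesgue_measure R).
Implicit Types (a b x y L : R) (f g : R -> R).

Lemma Rintegral_uniform_partition L (N : nat) f : 0 <= L -> (0 < N)%N ->
  mu.-integrable `]0, L[ (EFin \o f) ->
  \int[mu]_(x in `]0, L[) f x =
  \sum_(k < N) \int[mu]_(x in `]k%:R * L / N%:R, k.+1%:R * L / N%:R[) f x.
Proof.
move=> L0 N0 fi; have NR : 0 < N%:R :> R by rewrite ltr0n.
have key n : (n <= N)%N -> \int[mu]_(x in `]0, n%:R * L / N%:R[) f x =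
    \sum_(k < n) \int[mu]_(x in `]k%:R * L / N%:R, k.+1%:R * L / N%:R[) f x.
  elim: n => [_|n IH nN].
    by rewrite big_ord0 !mul0r set_itvoo0 Rintegral_set0.
  rewrite big_ord_recr/= -IH; last exact: ltnW.
  apply: Rintegral_itv_split.
  - by rewrite !mulr_ge0 ?invr_ge0// ltW.
  - by rewrite ler_pM2r ?invr_gt0// ler_wpM2r// ler_nat.
  - apply: integrableS fi => //; apply: subset_itv_oo => //.
    by rewrite ler_pdivrMr// mulrC ler_wpM2l// ler_nat.
by rewrite -key// mulrAC divff ?mul1r// gt_eqF.
Qed.

(** With [D] the integral of [g' ^+ 2] over the cell and [h] its length, any two values
    of [g] in the cell differ by at most the square root of [h * D].  Hence the
    integral of [g ^+ 2] is at most [2 h (g x)^2 + 2 h^2 D], while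
    [g y * g x >= (g x)^2 / 2 - h D / 2]. *)
Lemma cell_sampling L g g' a b x y : sobolev0 L g g' ->
  0 <= a -> a <= b -> b <= L -> x \in `[a, b] -> y \in `[a, b] ->
  sqnorm `]a, b[ g / 4 - (b - a) ^+ 2 * sqnorm `]a, b[ g' <=
  (b - a) * (g y * g x).
Proof.
move=> gg' a0 ab bL xab yab; set h := b - a; set D := sqnorm _ g'.
have h0 : 0 <= h by rewrite subr_ge0.
have L0 : 0 <= L by rewrite (le_trans a0)// (le_trans ab).
have inc t : t \in `[a, b] -> (g t - g x) ^+ 2 <= h * D.
  by move=> tab; exact: sobolev0_sqr_increment gg' _ _ _ _.
have Lg : L2fun `]a, b[ g.
  by apply: L2funS (sobolev0_L2fun L0 gg') => //; exact: subset_itv_oo.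
have gle : sqnorm `]a, b[ g <= (2 * g x ^+ 2 + 2 * (h * D)) * h.
  rewrite /h -(fine_itv_oo ab) -Rintegral_cst//.
  apply: le_Rintegral => //; first by case: Lg.
    exact: (@bounded_integrable _ _ _
      `|2 * g x ^+ 2 + 2 * (fine (mu `]a, b[) * D)|).
  move=> t tab; rewrite (fine_itv_oo ab) -/h.
  have := inc t (subset_itv_oo_cc tab).
  have := sqr_ge0 (g t - 2 * g x); nra.
have := inc y yab; have := sqr_ge0 (g y); have := sqr_ge0 (g x).
rewrite -/h => ? ? ?.
have : h * (g x ^+ 2 / 2 - h * D / 2) <= h * (g y * g x).
  by apply: ler_wpM2l => //; nra.
by move=> ?; nra.
Qed.

Lemma nodal_sampling L (N : nat) (xs xbars : 'I_N -> R) g g' :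
  0 <= L -> (0 < N)%N ->
  (forall k : 'I_N, xs k \in `[k%:R * L / N%:R, k.+1%:R * L / N%:R[) ->
  (forall k : 'I_N, xbars k \in `[k%:R * L / N%:R, k.+1%:R * L / N%:R[) ->
  sobolev0 L g g' ->
  sqnorm `]0, L[ g / 4 - (L / N%:R) ^+ 2 * sqnorm `]0, L[ g' <=
  \sum_(k < N) L / N%:R * (g (xbars k) * g (xs k)).
Proof.
move=> L0 N0 xsJ xbarsJ gg'; have NR : 0 < N%:R :> R by rewrite ltr0n.
have [_ g2] := sobolev0_L2fun L0 gg'; have [[_ g'2] _ _] := gg'.
rewrite {1 2}/sqnorm !(Rintegral_uniform_partition L0 N0)//.
rewrite mulr_suml mulr_sumr -sumrB; apply: ler_sum => k _.
have hE : k.+1%:R * L / N%:R - k%:R * L / N%:R = L / N%:R.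
  by rewrite -mulrBl -mulrBl -natrB// subSnn mul1r.
rewrite -hE; apply: (cell_sampling gg').
- by rewrite !mulr_ge0 ?invr_ge0// ltW.
- by rewrite -subr_ge0 hE divr_ge0// ltW.
- by rewrite ler_pdivrMr// mulrC ler_wpM2l// ler_nat.
- exact: subset_itv_co_cc (xsJ k).
- exact: subset_itv_co_cc (xbarsJ k).
Qed.

End NodalSampling.

(** * Comparison by Dini derivatives *)

Section DiniComparison.
Variable R : realType.
Implicit Types (y z : R -> R) (s t T : R).

Definition continuous_from0 z :=
  forall t, 0 <= t -> z s @[s --> within `[0, +oo[ (nbhs t)] --> z t.

Lemma continuous_from0P z t e : continuous_from0 z -> 0 <= t -> 0 < e ->
  exists2 d, 0 < d & forall s, 0 <= s -> `|t - s| < d -> `|z t - z s| < e.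
Proof.
move=> cz t0 e0; have /cvgrPdist_lt/(_ e e0) := cz t t0.
rewrite near_withinE => /nbhs_ballP[d d0 dP]; exists d => // s s0 sd.
by apply: dP; rewrite /= ?in_itv/= ?s0.
Qed.

(** For [e > 0], the set of the [t <= T] with [z t <= z 0 + e t] contains its
    supremum by continuity; if that were less than [T], the hypothesis at the
    supremum would produce a larger element. *)
Lemma dini_nonincreasing z : continuous_from0 z ->
  (forall s e, 0 <= s -> 0 < e -> exists2 d, 0 < d &
     forall t, s <= t -> t <= s + d -> z t - z s <= e * (t - s)) ->
  forall T, 0 <= T -> z T <= z 0.
Proof.
move=> cz dz T T0.
suff eps e : 0 < e -> z T <= z 0 + e * T.
  apply/ler_addgt0Pr => e e0.
  apply: (le_trans (eps (e / (T + 1)) _)); first by rewrite divr_gt0// ltr_wpDl.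
  rewrite lerD2l mulrAC ler_pdivrMr ?ltr_wpDl// ler_wpM2l ?(ltW e0)//.
  by rewrite lerDl.
move=> e0; pose S := [set t | [/\ 0 <= t, t <= T & z t <= z 0 + e * t]].
have S0 : S 0 by split => //; rewrite mulr0 addr0.
have ubS : ubound S T by move=> t [].
have hS : has_sup S by split; [exists 0|exists T].
pose m := sup S.
have m0 : 0 <= m by apply: ub_le_sup => //; exists T.
have mT : m <= T by apply: ge_sup => //; exists 0.
have Sm : z m <= z 0 + e * m.
  rewrite leNgt; apply/negP => lt_m.
  have gap0 : 0 < z m - (z 0 + e * m) by rewrite subr_gt0.
  have [d d0 dP] := continuous_from0P cz m0 gap0.
  have [t [t0 tT tS] mt] := sup_adherent d0 hS.
  have tm : t <= m by apply: ub_le_sup => //; exists T.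
  have := dP t t0; rewrite ger0_norm ?subr_ge0// ltrBlDl -ltrBlDr => /(_ mt).
  rewrite ltr_norml => /andP[_].
  have : e * t <= e * m by rewrite ler_wpM2l// ltW.
  by lra.
have [<-//|mTne] := eqVneq m T.
have ltmT : m < T by rewrite lt_neqAle mTne.
have [d d0 dP] := dz m e m0 e0.
pose t := Num.min T (m + d).
have mt : m < t by rewrite lt_min ltmT ltrDl.
have tT : t <= T by rewrite ge_min lexx.
have tmd : t <= m + d by rewrite ge_min lexx orbT.
suff /(ub_le_sup (ex_intro _ T ubS)) : S t by rewrite leNgt mt.
split=> //; first by rewrite (le_trans m0)// ltW.
by have := dP t (ltW mt) tmd; lra.
Qed.

(** The Dini derivative of [expR (c * t) * y t] is nonpositive; as [y] need not be
    differentiable, the product rule is replaced by the convexity inequality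
    [expR (c t) - expR (c s) <= c (t - s) expR (c t)], multiplied by [0 <= y s]. *)
Lemma dini_exponential_decay y c : (forall t, 0 <= y t) -> continuous_from0 y ->
  (forall s e, 0 <= s -> 0 < e -> exists2 d, 0 < d &
     forall t, s <= t -> t <= s + d -> y t - y s <= (t - s) * (e - c * y s)) ->
  forall T, 0 <= T -> y T <= expR (- c * T) * y 0.
Proof.
move=> y0 cy dy T T0.
pose z t := expR (c * t) * y t.
suff : z T <= z 0.
  rewrite /z mulr0 expR0 mul1r => zT.
  by rewrite mulNr expRN ler_pdivlMl ?expR_gt0.
apply: dini_nonincreasing => //.
  move=> t t0; apply: cvgM; last exact: cy.
  apply: cvg_within_filter; apply: (cvg_comp (fun s => c * s) expR).
    by apply: cvgM; [exact: cvg_cst|exact: cvg_id].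
  exact: continuous_expR.
move=> s e s0 e0; pose M := expR (`|c| * (s + 1)).
have M0 : 0 < M := expR_gt0 _.
have [d d0 dP] := dy s (e / M) s0 (divr_gt0 e0 M0).
(* staying within distance 1 of [s] keeps [expR (c * t)] below [M] *)
exists (Num.min d 1); first by rewrite lt_min d0 ltr01.
move=> t st td.
have tsd : t <= s + d by rewrite (le_trans td)// lerD2l ge_min lexx.
have ts1 : t <= s + 1 by rewrite (le_trans td)// lerD2l ge_min lexx orbT.
have ts0 : 0 <= t - s by rewrite subr_ge0.
have E0 : 0 < expR (c * t) := expR_gt0 _.
have EM : expR (c * t) <= M.
  rewrite ler_expR (le_trans (ler_norm _))// normrM ler_wpM2l//.
  by rewrite ger0_norm// (le_trans s0).
have conv : expR (c * t) - expR (c * s) <= c * (t - s) * expR (c * t).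
  have -> : expR (c * s) = expR (c * t) * expR (- (c * (t - s))).
    by rewrite -expRD; congr expR; ring.
  have := expR_ge1Dx (- (c * (t - s))); nra.
have inc := dP t st tsd.
have : expR (c * t) * (y t - y s) <=
       expR (c * t) * ((t - s) * (e / M - c * y s)) by rewrite ler_pM2l.
have : (expR (c * t) - expR (c * s)) * y s <=
       c * (t - s) * expR (c * t) * y s by rewrite ler_wpM2r.
have : (t - s) * (expR (c * t) * (e / M)) <= (t - s) * e.
  by rewrite ler_wpM2l// mulrCA ler_piMr ?(ltW e0)// ler_pdivrMr// mul1r.
rewrite /z => ? ? ?; lra.
Qed.

End DiniComparison.

(** * Real and imaginary parts *)

Section ComplexParts.
Variable R : realType.
Notation mu := (@lebesgue_measure R).
Notation re := (@complex.Re R).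
Notation im := (@complex.Im R).
Implicit Types (L : R) (f g : R -> R[i]) (z w : R[i]).

Lemma reD z w : re (z + w) = re z + re w.
Proof. by case: z; case: w. Qed.

Lemma imD z w : im (z + w) = im z + im w.
Proof. by case: z; case: w. Qed.

Lemma reN z : re (- z) = - re z.
Proof. by case: z. Qed.

Lemma imN z : im (- z) = - im z.
Proof. by case: z. Qed.

Lemma reM z w : re (z * w) = re z * re w - im z * im w.
Proof. by case: z; case: w. Qed.

Lemma imM z w : im (z * w) = re z * im w + im z * re w.
Proof. by case: z => a b; case: w => c d /=. Qed.

Lemma reZ (a : R) z : re (a%:C * z) = a * re z.
Proof. by rewrite reM /= mul0r subr0. Qed.

Lemma imZ (a : R) z : im (a%:C * z) = a * im z.
Proof. by rewrite imM /= mul0r addr0. Qed.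

Lemma re_conjc z : re (conjc z) = re z.
Proof. by case: z. Qed.

Lemma im_conjc z : im (conjc z) = - im z.
Proof. by case: z. Qed.

Lemma re_sum (I : finType) (F : I -> R[i]) : re (\sum_i F i) = \sum_i re (F i).
Proof. by apply: (big_morph _ reD). Qed.

Lemma complex_eq z w : re z = re w -> im z = im w -> z = w.
Proof. by case: z => a b; case: w => c d /= -> ->. Qed.

Lemma cmod_sqr z : cmod z ^+ 2 = re z ^+ 2 + im z ^+ 2.
Proof.
by case: z => a b; rewrite /cmod /Normc.normc sqr_sqrtr// addr_ge0 ?sqr_ge0.
Qed.

Lemma cmod_ge0 z : 0 <= cmod z.
Proof. by case: z => a b; rewrite /cmod /Normc.normc sqrtr_ge0. Qed.

Lemma cmod_le z : cmod z <= `|re z| + `|im z|.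
Proof.
rewrite -ler_sqr ?nnegrE ?cmod_ge0 ?addr_ge0// cmod_sqr.
rewrite sqrrD -!(real_normK (num_real (re z))) -!(real_normK (num_real (im z))).
by rewrite lerD2r lerDl mulrn_wge0// mulr_ge0.
Qed.

Lemma squareIntegrableP L f : squareIntegrable L f <->
  L2fun `]0, L[ (re \o f) /\ L2fun `]0, L[ (im \o f).
Proof.
split=> [[[mr mi] fi]|[[mr r2] [mi i2]]].
  have mc : measurable_fun `]0, L[ (fun x => cmod (f x) ^+ 2).
    rewrite (_ : (fun x => _) = (fun x => re (f x) ^+ 2 + im (f x) ^+ 2)).
      by apply: measurable_funD; exact: measurable_funX.
    by apply/funext => x; rewrite cmod_sqr.
  have part (h : R -> R) : measurable_fun `]0, L[ h ->
      (forall x, h x ^+ 2 <= cmod (f x) ^+ 2) -> L2fun `]0, L[ h.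
    move=> mh hf; split => //; apply/integrableP; split.
      by apply/measurable_EFinP; exact: measurable_funX.
    apply: le_lt_trans fi; apply: ge0_le_integral => //.
    - by apply/measurable_EFinP; apply: measurableT_comp => //; exact: measurable_funX.
    - exact/measurable_EFinP.
    - by move=> x _ /=; rewrite lee_fin ger0_norm ?sqr_ge0.
  by split; (apply: part; [by []|move=> x]); rewrite cmod_sqr /= ?lerDl ?lerDr sqr_ge0.
split=> //; have := RintegrableD (measurable_itv_oo 0 L) r2 i2.
move=> /integrableP[_]; apply: le_lt_trans.
rewrite le_eqVlt; apply/orP; left; apply/eqP; apply: eq_integral => x _ /=.
by rewrite cmod_sqr ger0_norm// addr_ge0 ?sqr_ge0.
Qed.

Lemma H10P L f f' : H10 L f f' <->
  sobolev0 L (re \o f) (re \o f') /\ sobolev0 L (im \o f) (im \o f').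
Proof.
split=> [[/squareIntegrableP[Lr Li] fE fL]|[[Lr rE rL] [Li iE iL]]].
  by split; (split; [by []|move=> x xL|]); rewrite /= ?fL ?fE.
split; first exact/squareIntegrableP.
- by move=> x xL; apply: complex_eq; [exact: rE|exact: iE].
- exact: complex_eq.
Qed.

Definition csqnorm L f : R := sqnorm `]0, L[ (re \o f) + sqnorm `]0, L[ (im \o f).

Lemma csqnorm_ge0 L f : 0 <= csqnorm L f.
Proof. by rewrite addr_ge0 ?sqnorm_ge0. Qed.

Lemma L2normE L f : squareIntegrable L f -> L2norm L f = Num.sqrt (csqnorm L f).
Proof.
move=> /squareIntegrableP[[_ r2] [_ i2]]; rewrite /L2norm /csqnorm /sqnorm.
by rewrite -RintegralD//; congr Num.sqrt; apply: eq_Rintegral => x _;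
   rewrite cmod_sqr.
Qed.

Lemma H10_squareIntegrable L f f' : 0 <= L -> H10 L f f' -> squareIntegrable L f.
Proof.
move=> L0 /H10P[r i]; apply/squareIntegrableP.
by split; [exact: sobolev0_L2fun r|exact: sobolev0_L2fun i].
Qed.

Lemma H1norm_sqr L f f' : 0 <= L -> H10 L f f' ->
  H1norm L f f' ^+ 2 = csqnorm L f + csqnorm L f'.
Proof.
move=> L0 ff'; have [f'2 _ _] := ff'.
rewrite /H1norm (L2normE f'2) (L2normE (H10_squareIntegrable L0 ff')).
have n0 := csqnorm_ge0 L f; have n'0 := csqnorm_ge0 L f'.
by rewrite !sqr_sqrtr// addr_ge0.
Qed.

Lemma H10D L f f' g g' : H10 L f f' -> H10 L g g' ->
  H10 L (fun x => f x + g x) (fun x => f' x + g' x).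
Proof.
have reE h k : re \o (fun x : R => h x + k x) = (fun x => re (h x) + re (k x)).
  by apply/funext => x /=; rewrite reD.
have imE h k : im \o (fun x : R => h x + k x) = (fun x => im (h x) + im (k x)).
  by apply/funext => x /=; rewrite imD.
move=> /H10P[fr fi] /H10P[gr gi]; apply/H10P; rewrite !reE !imE.
by split; [exact: sobolev0D fr gr|exact: sobolev0D fi gi].
Qed.

Lemma H10Z L (a : R) f f' : H10 L f f' ->
  H10 L (fun x => a%:C * f x) (fun x => a%:C * f' x).
Proof.
have reE h : re \o (fun x : R => a%:C * h x) = (fun x => a * re (h x)).
  by apply/funext => x /=; rewrite -reZ.
have imE h : im \o (fun x : R => a%:C * h x) = (fun x => a * im (h x)).
  by apply/funext => x /=; rewrite -imZ.
move=> /H10P[fr fi]; apply/H10P; rewrite !reE !imE.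
by split; [exact: sobolev0Z fr|exact: sobolev0Z fi].
Qed.

Lemma H10B L f f' g g' : H10 L f f' -> H10 L g g' ->
  H10 L (fun x => f x - g x) (fun x => f' x - g' x).
Proof.
move=> ff' gg'; have := H10D ff' (H10Z (-1) gg').
have E (h k : R -> R[i]) : (fun x : R => h x + (-1)%:C * k x) = (fun x => h x - k x).
  by apply/funext => x; apply: complex_eq;
     rewrite ?(reD, imD, reN, imN, reZ, imZ) mulN1r.
by rewrite !E.
Qed.

Lemma re_L2prod L f g : re (L2prod L f g) =
  \int[mu]_(x in `]0, L[) (re (f x) * re (g x) + im (f x) * im (g x)).
Proof.
by apply: eq_Rintegral => x _; rewrite reM re_conjc im_conjc mulrN opprK.
Qed.

Lemma im_L2prod L f g : im (L2prod L f g) =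
  \int[mu]_(x in `]0, L[) (im (f x) * re (g x) - re (f x) * im (g x)).
Proof.
by apply: eq_Rintegral => x _; rewrite imM re_conjc im_conjc mulrN addrC.
Qed.

Lemma re_L2prod_split L f g : squareIntegrable L f -> squareIntegrable L g ->
  re (L2prod L f g) = \int[mu]_(x in `]0, L[) (re (f x) * re (g x)) +
                      \int[mu]_(x in `]0, L[) (im (f x) * im (g x)).
Proof.
move=> /squareIntegrableP[fr fi] /squareIntegrableP[gr gi].
rewrite re_L2prod RintegralD//.
- exact: (L2funM_integrable _ fr gr).
- exact: (L2funM_integrable _ fi gi).
Qed.

Lemma im_L2prod_split L f g : squareIntegrable L f -> squareIntegrable L g ->
  im (L2prod L f g) = \int[mu]_(x in `]0, L[) (im (f x) * re (g x)) -
                      \int[mu]_(x in `]0, L[) (re (f x) * im (g x)).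
Proof.
move=> /squareIntegrableP[fr fi] /squareIntegrableP[gr gi].
rewrite im_L2prod RintegralB//.
- exact: (L2funM_integrable _ fi gr).
- exact: (L2funM_integrable _ fr gi).
Qed.

Lemma re_L2prod_self L f : squareIntegrable L f -> re (L2prod L f f) = csqnorm L f.
Proof.
by move=> f2; rewrite re_L2prod_split// /csqnorm /sqnorm; congr (_ + _);
   apply: eq_Rintegral => x _; rewrite expr2.
Qed.

Lemma im_L2prod_self L f : im (L2prod L f f) = 0.
Proof.
rewrite im_L2prod (@eq_Rintegral _ _ _ mu _ (fun=> 0)).
  by rewrite Rintegral_cst// mul0r.
by move=> x _; rewrite mulrC subrr.
Qed.

End ComplexParts.

(** * The first Dirichlet eigenvalue *)

Section EigenvalueAndForm.
Variable R : realType.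
Notation mu := (@lebesgue_measure R).
Notation re := (@complex.Re R).
Notation im := (@complex.Im R).

Lemma re_L2prod_real (L : R) (s : R -> R) (phi : R -> R[i]) :
  re (L2prod L (fun x => (s x)%:C) phi) =
  \int[mu]_(x in `]0, L[) (s x * re (phi x)).
Proof. by rewrite re_L2prod; apply: eq_Rintegral => x _ /=; rewrite mul0r addr0. Qed.

Lemma im_L2prod_real (L : R) (s : R -> R) (phi : R -> R[i]) :
  L2fun `]0, L[ s -> L2fun `]0, L[ (im \o phi) ->
  im (L2prod L (fun x => (s x)%:C) phi) =
  - \int[mu]_(x in `]0, L[) (s x * im (phi x)).
Proof.
move=> Ls Lphi; rewrite im_L2prod -mulN1r -RintegralZl//.
  by apply: eq_Rintegral => x _ /=; rewrite mul0r sub0r mulN1r.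
exact: (L2funM_integrable _ Ls Lphi).
Qed.

Lemma sin_mode_eigenvalue (L : R) : 0 < L -> dirichlet_eigenvalue L ((pi / L) ^+ 2).
Proof.
move=> L0; set k := pi / L.
have ss' := sobolev0_sin L0.
have [Lc _ _] := ss'; have Ls := sobolev0_L2fun (ltW L0) ss'.
have zz : sobolev0 L (fun=> 0) (fun=> 0 : R).
  split=> // [|x _]; last by rewrite Rintegral_cst// mul0r.
  by apply: (@bounded_L2fun _ _ _ 0) => // x _; rewrite normr0.
exists (fun x => (sin (k * x))%:C), (fun x => (k * cos (k * x))%:C).
split; first exact/H10P.
- exists (L / 2).
    by rewrite in_itv/= divr_ge0 ?(ltW L0)//= ler_pdivrMr// ler_pMr// ler1n.
  rewrite mulrA divfK ?gt_eqF// sin_pihalf.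
  by move=> /(congr1 re)/= /eqP; rewrite oner_eq0.
- move=> phi phi' /H10P[phir phii].
  have [Lphii _ _] := phii.
  have Li := sobolev0_L2fun (ltW L0) phii.
  apply: complex_eq.
    by rewrite reZ !re_L2prod_real (weak_sin_mode L0 phir).
  by rewrite imZ !im_L2prod_real// mulrN (weak_sin_mode L0 phii).
Qed.

(** Minimality of [lambda1], applied to the eigenvalue [(pi / L) ^+ 2], reduces the
    claim to the sharp inequality. *)
Lemma poincare (L lambda1 : R) (g g' : R -> R) : 0 < L ->
  first_dirichlet_eigenvalue L lambda1 -> sobolev0 L g g' ->
  lambda1 * sqnorm `]0, L[ g <= sqnorm `]0, L[ g'.
Proof.
move=> L0 [_ lambda1_min] gg'; apply: le_trans (wirtinger L0 gg').
by rewrite ler_wpM2r ?sqnorm_ge0// lambda1_min//; exact: sin_mode_eigenvalue.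
Qed.

End EigenvalueAndForm.

(** * The spatial form of the equation *)

(** The linear bookkeeping of the energy estimate: [a], [b] are the squared norms of
    the real and imaginary parts, [a'], [b'] those of their derivatives, and [sr],
    [si] the nodal sums. *)
Lemma energy_arith (R : realType)
    (lambda mu gamma lambda1 h2 a b a' b' sr si K : R) :
  mu * (a / 4 - h2 * a' + (b / 4 - h2 * b')) <= mu * (sr + si) ->
  (lambda - mu * h2) * (lambda1 * a + lambda1 * b) <=
    (lambda - mu * h2) * (a' + b') ->
  0 <= K ->
  (lambda1 * (lambda - mu * h2) + (mu / 4 - gamma)) * (a + b) <=
    lambda * (a' + b') + K - gamma * (a + b) + mu * (sr + si).
Proof. by move=> ? ? ?; lra. Qed.

Section CglForm.
Variable R : realType.
Notation leb := (@lebesgue_measure R).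
Notation re := (@complex.Re R).
Notation im := (@complex.Im R).

Variables (L p lambda kappa gamma alpha beta mu : R) (N : nat).
Variables (xs xbars : 'I_N -> R).
Hypotheses (L_gt0 : 0 < L) (p_gt0 : 0 < p) (N_gt0 : (0 < N)%N).
Hypothesis xsJ : forall k : 'I_N, xs k \in `[k%:R * L / N%:R, k.+1%:R * L / N%:R[.
Hypothesis xbarsJ :
  forall k : 'I_N, xbars k \in `[k%:R * L / N%:R, k.+1%:R * L / N%:R[.

(** The sign is chosen so that the equation reads [ut t phi = - cgl_form ...], and
    dissipation is positivity of the real part of [cgl_form w w' w w']. *)
Definition cgl_form (w w' phi phi' : R -> R[i]) : R[i] :=
  (lambda +i* alpha) * L2prod L w' phi'
  + (kappa +i* beta) * L2prod L (fun x => (cmod (w x) `^ p)%:C * w x) phi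
  - gamma%:C * L2prod L w phi
  + mu%:C * \sum_(k < N) (L / N%:R)%:C * w (xbars k) * conjc (phi (xs k)).

Lemma re_cgl_form w w' phi phi' : re (cgl_form w w' phi phi') =
  (lambda * re (L2prod L w' phi') - alpha * im (L2prod L w' phi'))
  + (kappa * re (L2prod L (fun x => (cmod (w x) `^ p)%:C * w x) phi)
     - beta * im (L2prod L (fun x => (cmod (w x) `^ p)%:C * w x) phi))
  - gamma * re (L2prod L w phi)
  + mu * re (\sum_(k < N) (L / N%:R)%:C * w (xbars k) * conjc (phi (xs k))).
Proof. by rewrite /cgl_form 3!reD reN 2!reZ 2!(reM (_ +i* _)). Qed.

Lemma re_nodal_sum (w phi : R -> R[i]) :
  re (\sum_(k < N) (L / N%:R)%:C * w (xbars k) * conjc (phi (xs k))) =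
  \sum_(k < N) L / N%:R * (re (w (xbars k)) * re (phi (xs k)))
  + \sum_(k < N) L / N%:R * (im (w (xbars k)) * im (phi (xs k))).
Proof.
rewrite re_sum -big_split/=; apply: eq_bigr => k _.
by rewrite reM reZ imZ re_conjc im_conjc; ring.
Qed.

Lemma re_pow_L2prod (w phi : R -> R[i]) :
  re (L2prod L (fun x => (cmod (w x) `^ p)%:C * w x) phi) =
  \int[leb]_(x in `]0, L[)
    (cmod (w x) `^ p * (re (w x) * re (phi x) + im (w x) * im (phi x))).
Proof.
by rewrite re_L2prod; apply: eq_Rintegral => x _; rewrite reZ imZ; ring.
Qed.

Lemma im_pow_L2prod (w phi : R -> R[i]) :
  im (L2prod L (fun x => (cmod (w x) `^ p)%:C * w x) phi) =
  \int[leb]_(x in `]0, L[)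
    (cmod (w x) `^ p * (im (w x) * re (phi x) - re (w x) * im (phi x))).
Proof.
by rewrite im_L2prod; apply: eq_Rintegral => x _; rewrite reZ imZ; ring.
Qed.

Lemma cgl_form_coercive lambda1 w w' :
  0 < kappa -> 0 <= mu -> mu * (L / N%:R) ^+ 2 <= lambda ->
  first_dirichlet_eigenvalue L lambda1 -> H10 L w w' ->
  (lambda1 * (lambda - mu * (L / N%:R) ^+ 2) + (mu / 4 - gamma)) * csqnorm L w
    <= re (cgl_form w w' w w').
Proof.
move=> kappa0 mu0 mule lambda1P ww'; have [wr wi] := (H10P _ _ _).1 ww'.
have [w'2 _ _] := ww'; have w2 := H10_squareIntegrable (ltW L_gt0) ww'.
rewrite re_cgl_form im_L2prod_self mulr0 subr0.
rewrite !re_L2prod_self// re_pow_L2prod im_pow_L2prod re_nodal_sum.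
rewrite (_ : \int[leb]_(x in _) (_ * (im _ * _ - _)) = 0); last first.
  rewrite (@eq_Rintegral _ _ _ leb _ (fun=> 0)).
    by rewrite Rintegral_cst// mul0r.
  by move=> x _; rewrite mulrC [im _ * _]mulrC subrr mul0r.
rewrite mulr0 subr0.
have pow0 : 0 <= \int[leb]_(x in `]0, L[)
    (cmod (w x) `^ p * (re (w x) * re (w x) + im (w x) * im (w x))).
  apply: Rintegral_ge0 => x _; rewrite mulr_ge0 ?powR_ge0//.
  by rewrite addr_ge0// -expr2 sqr_ge0.
have sr := nodal_sampling (ltW L_gt0) N_gt0 xsJ xbarsJ wr.
have si := nodal_sampling (ltW L_gt0) N_gt0 xsJ xbarsJ wi.
have := ler_wpM2l mu0 (lerD sr si).
have poinr := poincare L_gt0 lambda1P wr.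
have poini := poincare L_gt0 lambda1P wi.
have lam0 : 0 <= lambda - mu * (L / N%:R) ^+ 2 by rewrite subr_ge0.
have := ler_wpM2l lam0 (lerD poinr poini).
have := mulr_ge0 (ltW kappa0) pow0.
rewrite /csqnorm /comp => Kpow lam_h samp.
exact: (energy_arith gamma samp lam_h Kpow).
Qed.

Lemma norm_Rintegral_le (f : R -> R) K : measurable_fun `]0, L[ f ->
  (forall x, x \in `]0, L[ -> `|f x| <= K) ->
  `|\int[leb]_(x in `]0, L[) f x| <= K * L.
Proof.
move=> mf fK.
have fi : leb.-integrable `]0, L[ (EFin \o f) by exact: bounded_integrable mf fK.
apply: le_trans (le_normr_Rintegral _ fi) _ => //.
have -> : K * L = \int[leb]_(x in `]0, L[) K.
  by rewrite Rintegral_cst// fine_itv_oo ?subr0// ltW.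
apply: le_Rintegral => //; first exact: integrable_norm.
by apply: (@bounded_integrable _ _ _ `|K|).
Qed.

Lemma node_in_itv (x : R) (k : 'I_N) :
  x \in `[k%:R * L / N%:R, k.+1%:R * L / N%:R[ -> x \in `[0, L].
Proof.
have NR : 0 < N%:R :> R by rewrite ltr0n.
rewrite !in_itv/= => /andP[kx xk]; apply/andP; split.
  by apply: le_trans kx; rewrite !mulr_ge0 ?invr_ge0// ltW.
apply: le_trans (ltW xk) _.
by rewrite ler_pdivrMr// mulrC ler_wpM2l ?(ltW L_gt0)// ler_nat.
Qed.

Lemma norm_linear2 (a b x y K : R) : `|x| <= K -> `|y| <= K ->
  `|a * x - b * y| <= (`|a| + `|b|) * K.
Proof.
move=> xK yK; rewrite (le_trans (ler_normB _ _))// !normrM mulrDl.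
by rewrite lerD// ler_wpM2l.
Qed.

Lemma norm_pair_le (a b c e M s : R) : `|a| <= M -> `|b| <= M ->
  `|c| <= s -> `|e| <= s -> `|a * c + b * e| <= 2 * (M * s).
Proof.
move=> aM bM cs es; rewrite (le_trans (ler_normD _ _))// !normrM.
by rewrite mulr2n mulrDl !mul1r lerD// ler_pM.
Qed.

(** Elements of H^1_0 are bounded in sup norm by the square root of [L] times the
    L^2 norm of their derivative, so all terms but the first are integrals or
    sums of bounded functions.  The constant depends on [w] only through the bound [m],
    which makes it uniform along a trajectory that is bounded in H^1_0. *)
Lemma cgl_form_bound m : 0 <= m -> exists2 C, 0 <= C &
  forall w w' phi phi' s, H10 L w w' -> H10 L phi phi' -> 0 <= s ->
    csqnorm L w' <= m ^+ 2 -> csqnorm L phi' <= s ^+ 2 ->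
    `|re (cgl_form w w' phi phi')| <= C * s.
Proof.
move=> m0; pose l := Num.sqrt L; have l0 : 0 <= l := sqrtr_ge0 _.
pose M := l * m; have M0 : 0 <= M by rewrite mulr_ge0.
pose C := (`|lambda| + `|alpha|) * (2 * m)
  + (`|kappa| + `|beta|) * ((M + M) `^ p * (2 * (M * l)) * L)
  + `|gamma| * (2 * (M * l) * L) + `|mu| * (2 * (M * l) * L).
exists C.
  by rewrite !addr_ge0 ?mulr_ge0 ?addr_ge0 ?mulr_ge0 ?powR_ge0 ?(ltW L_gt0).
move=> w w' phi phi' s ww' pp' s0 wm ps.
have [wr wi] := (H10P _ _ _).1 ww'; have [phir phii] := (H10P _ _ _).1 pp'.
have L0 := ltW L_gt0.
have parts (f : R -> R[i]) b : csqnorm L f <= b ->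
    sqnorm `]0, L[ (re \o f) <= b /\ sqnorm `]0, L[ (im \o f) <= b.
  rewrite /csqnorm; have := sqnorm_ge0 `]0, L[ (re \o f).
  by have := sqnorm_ge0 `]0, L[ (im \o f) => *; split; lra.
have [wrm wim] := parts _ _ wm; have [prs pis] := parts _ _ ps.
have wrM x : x \in `[0, L] -> `|re (w x)| <= M.
  by move=> /(sobolev0_norm_le wr); exact.
have wiM x : x \in `[0, L] -> `|im (w x)| <= M.
  by move=> /(sobolev0_norm_le wi); exact.
have prM x : x \in `[0, L] -> `|re (phi x)| <= l * s.
  by move=> /(sobolev0_norm_le phir); exact.
have piM x : x \in `[0, L] -> `|im (phi x)| <= l * s.
  by move=> /(sobolev0_norm_le phii); exact.
have mwr := sobolev0_measurable L0 wr; have mwi := sobolev0_measurable L0 wi.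
have mpr := sobolev0_measurable L0 phir; have mpi := sobolev0_measurable L0 phii.
have [w'2 _ _] := ww'; have [p'2 _ _] := pp'.
have [Lwr _ _] := wr; have [Lwi _ _] := wi.
have [Lpr _ _] := phir; have [Lpi _ _] := phii.
have mL := measurable_itv_oo 0 L.
have mpow : measurable_fun `]0, L[ (fun x => cmod (w x) `^ p).
  have mc : measurable_fun `]0, L[ (fun x => cmod (w x)).
    rewrite (_ : (fun x => _) =
        (fun x => Num.sqrt (re (w x) ^+ 2 + im (w x) ^+ 2))); last first.
      by apply/funext => x; rewrite -cmod_sqr sqrtr_sqr ger0_norm ?cmod_ge0.
    have msqrt : measurable_fun setT (@Num.sqrt R).
      by apply: continuous_measurable_fun; exact: sqrt_continuous.
    apply: (measurableT_comp msqrt).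
    by apply: measurable_funD; exact: measurable_funX.
  exact: (measurableT_comp (measurable_powR _) mc).
have powM x : x \in `[0, L] -> `|cmod (w x) `^ p| <= (M + M) `^ p.
  move=> xL; rewrite ger0_norm ?powR_ge0//.
  apply: ge0_ler_powR; rewrite ?nnegrE ?cmod_ge0 ?addr_ge0 ?(ltW p_gt0)//.
  by rewrite (le_trans (cmod_le _))// lerD ?wrM ?wiM.
have leading : `|lambda * re (L2prod L w' phi') - alpha * im (L2prod L w' phi')|
    <= (`|lambda| + `|alpha|) * (2 * (m * s)).
  apply: norm_linear2.
    rewrite re_L2prod_split// mulr2n mulrDl !mul1r (le_trans (ler_normD _ _))// lerD//.
      exact: (le_pairing mL Lwr Lpr).
    exact: (le_pairing mL Lwi Lpi).
  rewrite im_L2prod_split// mulr2n mulrDl !mul1r (le_trans (ler_normB _ _))// lerD//.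
    exact: (le_pairing mL Lwi Lpr).
  exact: (le_pairing mL Lwr Lpi).
have re_pair x : x \in `[0, L] ->
    `|re (w x) * re (phi x) + im (w x) * im (phi x)| <= 2 * (M * (l * s)).
  by move=> xL; apply: norm_pair_le; [exact: wrM|exact: wiM|exact: prM|exact: piM].
have im_pair x : x \in `[0, L] ->
    `|im (w x) * re (phi x) - re (w x) * im (phi x)| <= 2 * (M * (l * s)).
  move=> xL; rewrite -mulNr; apply: norm_pair_le; rewrite ?normrN.
  - exact: wiM.
  - exact: wrM.
  - exact: prM.
  - exact: piM.
have sub x : x \in `]0, L[ -> x \in `[0, L] by exact: subset_itv_oo_cc.
have nonlinear : `|kappa * re (L2prod L (fun x => (cmod (w x) `^ p)%:C * w x) phi)
     - beta * im (L2prod L (fun x => (cmod (w x) `^ p)%:C * w x) phi)|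
    <= (`|kappa| + `|beta|) * ((M + M) `^ p * (2 * (M * (l * s))) * L).
  apply: norm_linear2; rewrite ?re_pow_L2prod ?im_pow_L2prod;
    apply: norm_Rintegral_le.
  - apply: measurable_funM => //.
    by apply: measurable_funD; exact: measurable_funM.
  - by move=> x /sub xL; rewrite normrM ler_pM// ?powM// re_pair.
  - apply: measurable_funM => //.
    by apply: measurable_funB; exact: measurable_funM.
  - by move=> x /sub xL; rewrite normrM ler_pM// ?powM// im_pair.
have zeroth : `|gamma * re (L2prod L w phi)| <= `|gamma| * (2 * (M * (l * s)) * L).
  rewrite normrM ler_wpM2l// re_L2prod; apply: norm_Rintegral_le.
    by apply: measurable_funD; exact: measurable_funM.
  by move=> x /sub; exact: re_pair.
have nodal : `|mu * re (\sum_(k < N) (L / N%:R)%:C * w (xbars k) * conjc (phi (xs k)))|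
    <= `|mu| * (2 * (M * (l * s)) * L).
  rewrite normrM ler_wpM2l// re_nodal_sum -big_split/=.
  apply: (le_trans (ler_norm_sum _ _ _)).
  have -> : 2 * (M * (l * s)) * L = \sum_(k < N) L / N%:R * (2 * (M * (l * s))).
    rewrite sumr_const card_ord -[RHS]mulr_natr [RHS]mulrAC.
    by rewrite divfK 1?mulrC// pnatr_eq0 -lt0n.
  apply: ler_sum => k _; rewrite -mulrDr normrM ger0_norm ?divr_ge0//.
  rewrite ler_wpM2l ?divr_ge0//.
  have xL := node_in_itv (xsJ k); have xbL := node_in_itv (xbarsJ k).
  by apply: norm_pair_le; [exact: wrM|exact: wiM|exact: prM|exact: piM].
rewrite re_cgl_form (le_trans (ler_normD _ _))//.
have -> : C * s = (`|lambda| + `|alpha|) * (2 * (m * s))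
  + (`|kappa| + `|beta|) * ((M + M) `^ p * (2 * (M * (l * s))) * L)
  + `|gamma| * (2 * (M * (l * s)) * L) + `|mu| * (2 * (M * (l * s)) * L).
  by rewrite /C; ring.
apply: lerD => //; apply: le_trans (ler_normB _ _) _; apply: lerD => //.
by apply: le_trans (ler_normD _ _) _; exact: lerD.
Qed.

End CglForm.

(** * Squared L^2 norm along a trajectory *)

Section EnergyInTime.
Variable R : realType.
Notation leb := (@lebesgue_measure R).
Notation re := (@complex.Re R).
Notation im := (@complex.Im R).

Lemma ae_bounded_Rintegral (D : set R) (f : R -> R) (M B : R) :
  measurable D -> (leb D < +oo)%E -> measurable_fun D f ->
  {ae leb, forall r, D r -> `|f r| <= M /\ f r <= B} ->
  leb.-integrable D (EFin \o f) /\ \int[leb]_(r in D) f r <= B * fine (leb D).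
Proof.
move=> mD Dfin mf [Nu [mNu Nu0 Nusub]].
have good r : (D `\` Nu) r -> `|f r| <= M /\ f r <= B.
  by move=> [Dr Nur]; apply: contrapT => bad; apply/Nur/Nusub => /(_ Dr).
have mDN : measurable (D `\` Nu) by exact: measurableD.
have DNfin : (leb (D `\` Nu) < +oo)%E.
  by apply: le_lt_trans Dfin; apply: le_measure; rewrite ?inE.
have fi : leb.-integrable D (EFin \o f).
  apply/(negligible_integrable mNu mD _ Nu0); first exact/measurable_EFinP.
  apply: (@bounded_integrable _ _ _ M) => //.
    by apply: measurable_funS mf => //; exact: subDsetl.
  by move=> r /good[].
split=> //; rewrite -(Rintegral_cst leb mD).
have Bi : leb.-integrable D (EFin \o (fun=> B)).
  exact: (@bounded_integrable _ _ _ `|B|).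
rewrite /Rintegral (negligible_integral mNu mD fi Nu0).
rewrite (negligible_integral mNu mD Bi Nu0).
apply: le_Rintegral => //.
- by apply: integrableS fi => //; exact: subDsetl.
- by apply: integrableS Bi => //; exact: subDsetl.
- by move=> r /good[].
Qed.

Lemma csqnormE L (f : R -> R[i]) : squareIntegrable L f ->
  csqnorm L f = \int[leb]_(x in `]0, L[) (re (f x) ^+ 2 + im (f x) ^+ 2).
Proof. by move=> /squareIntegrableP[[_ r2] [_ i2]]; rewrite RintegralD. Qed.

(** The real part of the pairing is symmetric, so the cross terms cancel.  This is
    what turns the weak time derivative, tested against the fixed function
    [u t + u s], into an increment of the energy. *)
Lemma csqnorm_difference L (f g : R -> R[i]) :
  squareIntegrable L f -> squareIntegrable L g ->
  csqnorm L f - csqnorm L g = re (L2prod L f (fun x => f x + g x)) -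
                              re (L2prod L g (fun x => f x + g x)).
Proof.
move=> f2 g2; have [fr fi] := (squareIntegrableP _ _).1 f2.
have [gr gi] := (squareIntegrableP _ _).1 g2.
have mL := measurable_itv_oo 0 L.
have sr := L2funD mL fr gr; have si := L2funD mL fi gi.
have pairing (h : R -> R[i]) :
    L2fun `]0, L[ (re \o h) -> L2fun `]0, L[ (im \o h) ->
    leb.-integrable `]0, L[ (EFin \o (fun x =>
      re (h x) * re (f x + g x) + im (h x) * im (f x + g x))).
  move=> hr hi; apply: Rintegrable_eq
    (RintegrableD mL (L2funM_integrable mL hr sr) (L2funM_integrable mL hi si)) => //.
  by move=> x _ /=; rewrite reD imD.
rewrite !csqnormE// !re_L2prod -!RintegralB//.
- by apply: eq_Rintegral => x _; rewrite reD imD; ring.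
- exact: pairing.
- exact: pairing.
- by case: fr fi => [_ fr2] [_ fi2]; exact: RintegrableD.
- by case: gr gi => [_ gr2] [_ gi2]; exact: RintegrableD.
Qed.

Lemma csqnormDZ L (f g : R -> R[i]) (a : R) :
  squareIntegrable L f -> squareIntegrable L g ->
  csqnorm L (fun x => a%:C * f x + g x) =
  a ^+ 2 * csqnorm L f + 2 * a * re (L2prod L f g) + csqnorm L g.
Proof.
move=> f2 g2; have [fr fi] := (squareIntegrableP _ _).1 f2.
have [gr gi] := (squareIntegrableP _ _).1 g2.
rewrite {1}/csqnorm.
have -> : re \o (fun x => a%:C * f x + g x) = (fun x => a * re (f x) + re (g x)).
  by apply/funext => x /=; rewrite reD reZ.
have -> : im \o (fun x => a%:C * f x + g x) = (fun x => a * im (f x) + im (g x)).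
  by apply/funext => x /=; rewrite imD imZ.
rewrite (sqnormDZ _ _ fr gr)// (sqnormDZ _ _ fi gi)// re_L2prod_split//.
by rewrite /csqnorm /comp; ring.
Qed.

Lemma cauchy_schwarz_re_L2prod L (f g : R -> R[i]) :
  squareIntegrable L f -> squareIntegrable L g ->
  re (L2prod L f g) ^+ 2 <= csqnorm L f * csqnorm L g.
Proof.
move=> f2 g2; apply: discriminant_le0; first exact: csqnorm_ge0.
by move=> a; rewrite -csqnormDZ//; exact: csqnorm_ge0.
Qed.

Lemma norm_re_L2prod_le L (f g : R -> R[i]) (a b : R) :
  squareIntegrable L f -> squareIntegrable L g -> 0 <= a -> 0 <= b ->
  csqnorm L f <= a ^+ 2 -> csqnorm L g <= b ^+ 2 -> `|re (L2prod L f g)| <= a * b.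
Proof.
move=> f2 g2 a0 b0 fa gb.
rewrite -ler_sqr ?nnegrE ?mulr_ge0// real_normK ?num_real// exprMn.
by rewrite (le_trans (cauchy_schwarz_re_L2prod f2 g2))// ler_pM// csqnorm_ge0.
Qed.

Lemma le_csqnormDZ L (f g : R -> R[i]) (c a b : R) :
  squareIntegrable L f -> squareIntegrable L g -> 0 <= a -> 0 <= b ->
  csqnorm L f <= a ^+ 2 -> csqnorm L g <= b ^+ 2 ->
  csqnorm L (fun x => c%:C * f x + g x) <= (`|c| * a + b) ^+ 2.
Proof.
move=> f2 g2 a0 b0 fa gb; rewrite csqnormDZ//.
have ab := norm_re_L2prod_le f2 g2 a0 b0 fa gb.
have cab : c * re (L2prod L f g) <= `|c| * (a * b).
  by rewrite (le_trans (ler_norm _))// normrM ler_wpM2l.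
have cf : c ^+ 2 * csqnorm L f <= c ^+ 2 * a ^+ 2 by rewrite ler_wpM2l ?sqr_ge0.
rewrite sqrrD exprMn real_normK ?num_real//.
by move: cab cf gb => ? ? ?; lra.
Qed.

Lemma continuous_H10_csqnorm (L : R) (u ux : R -> R -> R[i]) (t e : R) :
  0 <= L -> continuous_H10 L u ux -> 0 <= t -> 0 < e ->
  exists2 d, 0 < d & forall s, 0 <= s -> `|t - s| < d ->
    csqnorm L (fun x => u s x - u t x) <= e ^+ 2 /\
    csqnorm L (fun x => ux s x - ux t x) <= e ^+ 2.
Proof.
move=> L0 [uH ucont] t0 e0; have /cvgrPdist_lt/(_ e e0) := ucont t t0.
rewrite near_withinE => /nbhs_ballP[d d0 dP]; exists d => // s s0 sd.
have := dP s sd; rewrite /= in_itv/= s0 => /(_ isT).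
have hH := H10B (uH s s0) (uH t t0).
rewrite sub0r normrN => /ltW.
rewrite -ler_sqr ?nnegrE ?(ltW e0)// real_normK ?num_real// (H1norm_sqr L0 hH).
have := csqnorm_ge0 L (fun x => u s x - u t x).
have := csqnorm_ge0 L (fun x => ux s x - ux t x).
by move=> ? ? ?; split; lra.
Qed.

Lemma csqnorm_continuous (L : R) (u ux : R -> R -> R[i]) :
  0 <= L -> continuous_H10 L u ux -> continuous_from0 (fun t => csqnorm L (u t)).
Proof.
move=> L0 uc t t0; have [uH _] := uc.
apply/cvgrPdist_le => e e0; rewrite near_withinE.
have sq r : 0 <= r -> squareIntegrable L (u r).
  by move=> r0; exact: H10_squareIntegrable (uH r r0).
pose A := Num.sqrt (csqnorm L (u t)); have A0 : 0 <= A := sqrtr_ge0 _.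
have AE : csqnorm L (u t) = A ^+ 2 by rewrite sqr_sqrtr// csqnorm_ge0.
pose h := Num.min 1 (e / (2 * A + 1)).
have A1 : 0 < 2 * A + 1 by rewrite ltr_wpDl// mulr_ge0.
have h0 : 0 < h by rewrite lt_min ltr01 divr_gt0.
have [d d0 dP] := continuous_H10_csqnorm L0 uc t0 h0.
apply/nbhs_ballP; exists d => // s sd /=; rewrite in_itv/= andbT => s0.
have [du _] := dP s s0 sd.
have d2 : squareIntegrable L (fun x => u s x - u t x).
  exact: H10_squareIntegrable (H10B (uH s s0) (uH t t0)).
have -> : u s = (fun x => 1%:C * u t x + (u s x - u t x)).
  by apply/funext => x; rewrite mul1r addrC subrK.
rewrite csqnormDZ//; last exact: sq.
rewrite expr1n mul1r mulr1 distrC -[X in X - _]addrA [X in `|X|]addrC addKr.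
have := norm_re_L2prod_le (sq t t0) d2 A0 (ltW h0) _ du; rewrite AE lexx => /(_ isT).
have := csqnorm_ge0 L (fun x => u s x - u t x); set D := csqnorm _ _ in du *.
move=> D0 ip; rewrite (le_trans (ler_normD _ _))// (ger0_norm D0) normrM ger0_norm//.
have h1 : h <= 1 by rewrite ge_min lexx.
have hA : (2 * A + 1) * h <= e.
  by rewrite mulrC -ler_pdivlMr// ge_min lexx orbT.
have hh : h ^+ 2 <= h by rewrite expr2 ler_piMl// ltW.
by move: (le_trans du hh) hA ip => ? ? ?; lra.
Qed.

End EnergyInTime.

(** * Decay of the energy *)

Section EnergyDecay.
Variable R : realType.
Notation leb := (@lebesgue_measure R).
Notation re := (@complex.Re R).
Notation im := (@complex.Im R).

(** For [r] between [s] and [t], write [u t + u s = 2 u(r) + psi] with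
    [psi = (u t - u s) - 2 (u(r) - u s)].  The first part contributes at most
    [- 2 omega] times the energy at [r] by coercivity; the second one tends to 0 with
    [t - s] since [psi] does so in H^1 and the form is bounded. *)
Lemma energy_dini (L : R) (u ux : R -> R -> R[i]) (ut : R -> (R -> R[i]) -> R[i])
    (form : (R -> R[i]) -> (R -> R[i]) -> (R -> R[i]) -> (R -> R[i]) -> R[i])
    (omega : R) :
  0 <= L -> continuous_H10 L u ux -> L2loc_Hm1 L ut -> time_derivative L u ut ->
  {ae leb, forall t : R, 0 < t -> forall phi phi', H10 L phi phi' ->
     ut t phi = - form (u t) (ux t) phi phi'} ->
  (forall w w', H10 L w w' -> omega * csqnorm L w <= re (form w w' w w')) ->
  (forall m, 0 <= m -> exists2 C, 0 <= C &
     forall w w' phi phi' s, H10 L w w' -> H10 L phi phi' -> 0 <= s ->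
       csqnorm L w' <= m ^+ 2 -> csqnorm L phi' <= s ^+ 2 ->
       `|re (form w w' phi phi')| <= C * s) ->
  forall s e, 0 <= s -> 0 < e -> exists2 d, 0 < d &
    forall t, s <= t -> t <= s + d ->
      csqnorm L (u t) - csqnorm L (u s) <=
      (t - s) * (e - 2 * omega * csqnorm L (u s)).
Proof.
move=> L0 uc [utH utm _] du eqn coer bnd s e s0 e0.
have [uH _] := uc.
have sq r : 0 <= r -> squareIntegrable L (u r).
  by move=> r0; exact: H10_squareIntegrable (uH r r0).
have sqx r : 0 <= r -> squareIntegrable L (ux r) by move=> /uH[].
pose m := Num.sqrt (csqnorm L (ux s)); have m0 : 0 <= m := sqrtr_ge0 _.
have mE : csqnorm L (ux s) <= m ^+ 2 by rewrite sqr_sqrtr// csqnorm_ge0.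
have m10 : 0 <= m + 1 by rewrite addr_ge0.
have [C C0 CP] := bnd (m + 1) m10.
(* [eta] bounds the H^1 distance to [u s]: half of [e] pays for [psi], the other
   half for the variation of the energy between [s] and [r] *)
pose eta := Num.min 1 (e / 2 / (3 * C + 1)).
have C1 : 0 < 3 * C + 1 by rewrite ltr_wpDl// mulr_ge0.
have eta0 : 0 < eta by rewrite lt_min ltr01 !divr_gt0.
have eta1 : eta <= 1 by rewrite ge_min lexx.
have etaC : C * (3 * eta) <= e / 2.
  have : eta * (3 * C + 1) <= e / 2 by rewrite -ler_pdivlMr// ge_min lexx orbT.
  by move: (ltW eta0) => ? ?; lra.
pose om := `|omega|; have om0 : 0 <= om := normr_ge0 _.
have om1 : 0 < 2 * om + 1 by rewrite ltr_wpDl// mulr_ge0.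
have [d1 d10 d1P] := continuous_H10_csqnorm L0 uc s0 eta0.
have e20 : 0 < e / 2 / (2 * om + 1) by rewrite !divr_gt0.
have [d2 d20 d2P] := continuous_from0P (csqnorm_continuous L0 uc) s0 e20.
pose d := Num.min d1 d2 / 2.
have dmin : d < Num.min d1 d2.
  by rewrite ltr_pdivrMr// ltr_pMr ?ltr1n// lt_min d10.
have d0 : 0 < d by rewrite divr_gt0// lt_min d10.
exists d => // t st td.
have t0 : 0 <= t := le_trans s0 st.
have close r : s <= r -> r <= t -> `|s - r| < d1 /\ `|s - r| < d2.
  move=> sr rt; have : `|s - r| < Num.min d1 d2.
    rewrite distrC ger0_norm ?subr_ge0//; apply: le_lt_trans dmin.
    by rewrite lerBlDl (le_trans rt).
  by rewrite lt_min => /andP[].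
have near_s r : s <= r -> r <= t -> csqnorm L (fun x => ux r x - ux s x) <= eta ^+ 2.
  move=> sr rt; have [c1 _] := close r sr rt.
  by have [] := d1P r (le_trans s0 sr) c1.
have dsq r : 0 <= r -> squareIntegrable L (fun x => ux r x - ux s x).
  by move=> r0; case: (H10B (uH r r0) (uH s s0)).
have bounded r : s <= r -> r <= t -> csqnorm L (ux r) <= (m + 1) ^+ 2.
  move=> sr rt; have r0 := le_trans s0 sr.
  have -> : ux r = (fun x => 1%:C * ux s x + (ux r x - ux s x)).
    by apply/funext => x; rewrite mul1r addrC subrK.
  apply: le_trans
    (le_csqnormDZ 1 (sqx s s0) (dsq r r0) m0 (ltW eta0) mE (near_s r sr rt)) _.
  rewrite normr1 mul1r ler_sqr ?nnegrE ?addr_ge0 ?(ltW eta0)//.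
  by rewrite lerD2l.
pose phi x := u t x + u s x; pose phi' x := ux t x + ux s x.
have phiH : H10 L phi phi' by exact: H10D (uH t t0) (uH s s0).
have phi'le : csqnorm L phi' <= ((m + 1) + (m + 1)) ^+ 2.
  have -> : phi' = (fun x => 1%:C * ux t x + ux s x).
    by apply/funext => x; rewrite mul1r.
  have := le_csqnormDZ 1 (sqx t t0) (sqx s s0) m10 m10
    (bounded t st (lexx _)) (bounded s (lexx _) st).
  by rewrite normr1 mul1r.
pose B := e - 2 * omega * csqnorm L (u s).
pose M := C * ((m + 1) + (m + 1)).
have rate r : s <= r -> r <= t ->
    (forall phi phi', H10 L phi phi' -> ut r phi = - form (u r) (ux r) phi phi') ->
    `|re (ut r phi)| <= M /\ re (ut r phi) <= B.
  move=> sr rt eqr; have r0 := le_trans s0 sr.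
  split.
    rewrite (eqr _ _ phiH) reN normrN; apply: CP => //; first exact: uH.
      exact: addr_ge0.
    exact: bounded.
  pose psi x := (-2)%:C * (u r x - u s x) + (u t x - u s x).
  pose psi' x := (-2)%:C * (ux r x - ux s x) + (ux t x - ux s x).
  have psiH : H10 L psi psi'.
    by apply: H10D; [apply: H10Z|]; apply: H10B; exact: uH.
  have psi'le : csqnorm L psi' <= (3 * eta) ^+ 2.
    have := le_csqnormDZ (-2) (dsq r r0) (dsq t t0) (ltW eta0) (ltW eta0)
      (near_s r sr rt) (near_s t st (lexx _)).
    rewrite normrN ger0_norm// => /le_trans; apply.
    by rewrite (_ : 2 * eta + eta = 3 * eta)//; ring.
  have -> : phi = (fun x => (2 : R)%:C * u r x + psi x).
    apply/funext => x; rewrite /phi /psi; apply: complex_eq.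
      by rewrite !(reD, reZ, reN); ring.
    by rewrite !(imD, imZ, imN); ring.
  have [lin _] := utH r r0.
  rewrite (lin _ _ _ _ _ (uH r r0) psiH) reD reM re_conjc im_conjc /=.
  rewrite oppr0 mul0r subr0 (eqr _ _ (uH r r0)) (eqr _ _ psiH) !reN.
  have coer_r := coer _ _ (uH r r0).
  have psi_bnd : `|re (form (u r) (ux r) psi psi')| <= C * (3 * eta).
    apply: CP => //; [exact: uH| |exact: bounded].
    by rewrite mulr_ge0// ltW.
  have [_ c2] := close r sr rt.
  have := d2P r r0 c2; set yr := csqnorm L (u r); set ys := csqnorm L (u s) => yrs.
  have drift : omega * (ys - yr) <= e / 4.
    rewrite (le_trans (ler_norm _))// normrM -/om.
    have : om * `|ys - yr| <= om * (e / 2 / (2 * om + 1)).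
      by rewrite ler_wpM2l// ltW.
    move=> /le_trans; apply; rewrite mulrA ler_pdivrMr//.
    by move: om0 e0 => ? ?; nra.
  move: psi_bnd; rewrite ler_norml => /andP[psi_bnd _].
  rewrite /B -/ys; move: coer_r drift etaC psi_bnd; rewrite -/yr => ? ? ? ?; lra.
have [utre _] := utm _ _ phiH.
have mf : measurable_fun `]s, t[ (fun r => re (ut r phi)).
  apply: measurable_funS utre => // r /=; rewrite !in_itv/= andbT => /andP[sr _].
  exact/ltW/(le_lt_trans s0).
have [intf intle] : leb.-integrable `]s, t[ (EFin \o (fun r => re (ut r phi))) /\
    \int[leb]_(r in `]s, t[) re (ut r phi) <= B * fine (leb `]s, t[).
  apply: (@ae_bounded_Rintegral _ _ _ M B) => //.
  apply: (@filterS _ _ (ae_filter_ringOfSetsType (@lebesgue_measure R))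
    _ _ _ eqn) => r eqr /=.
  rewrite in_itv/= => /andP[sr rt].
  by apply: rate; [exact: ltW|exact: ltW|exact: eqr (le_lt_trans s0 sr)].
rewrite (csqnorm_difference (sq t t0) (sq s s0)) -/phi.
have := congr1 re (du s t s0 st phi phi' phiH).
rewrite reD reN => ->.
rewrite [leLHS](Rintegral_itv_oo_cc intf) mulrC.
by move: intle; rewrite fine_itv_oo.
Qed.

Lemma L2norm_exponential_decay (L : R) (u : R -> R -> R[i]) (omega : R) :
  (forall t, 0 <= t -> squareIntegrable L (u t)) ->
  continuous_from0 (fun t => csqnorm L (u t)) ->
  (forall s e, 0 <= s -> 0 < e -> exists2 d, 0 < d &
    forall t, s <= t -> t <= s + d ->
      csqnorm L (u t) - csqnorm L (u s) <=
      (t - s) * (e - 2 * omega * csqnorm L (u s))) ->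
  forall t, 0 <= t -> L2norm L (u t) <= expR (- omega * t) * L2norm L (u 0).
Proof.
move=> sq cont dini t t0.
have := dini_exponential_decay (fun t => csqnorm_ge0 L (u t)) cont dini t0.
rewrite (L2normE (sq t t0)) (L2normE (sq 0 (lexx _))).
have E0 := expR_ge0 (- omega * t).
have -> : expR (- (2 * omega) * t) = expR (- omega * t) ^+ 2.
  by rewrite expr2 -expRD; congr expR; ring.
move=> le_t; rewrite -[X in X * _](ger0_norm E0) -sqrtr_sqr -sqrtrM ?sqr_ge0//.
by rewrite ler_sqrt// mulr_ge0 ?sqr_ge0 ?csqnorm_ge0.
Qed.

End EnergyDecay.

Theorem theorem5p1 (R : realType)
    (L p lambda kappa gamma alpha beta mu lambda1 : R) (N : nat)
    (xs xbars : 'I_N -> R) (u : R -> R -> R[i])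
    (L_gt0 : 0 < L) (p_gt0 : 0 < p)
    (lambda_gt0 : 0 < lambda) (kappa_gt0 : 0 < kappa) (gamma_gt0 : 0 < gamma)
    (N_gt0 : (0 < N)%N)
    (xsJ : forall k : 'I_N,
       xs k \in `[k%:R * L / N%:R, k.+1%:R * L / N%:R[)
    (xbarsJ : forall k : 'I_N,
       xbars k \in `[k%:R * L / N%:R, k.+1%:R * L / N%:R[)
    (lambda1P : first_dirichlet_eigenvalue L lambda1)
    (lambda_ge : mu * (L / N%:R) ^+ 2 <= lambda)
    (gamma_lt : gamma < mu / 4)
    (u_sol : nodal_feedback_cgl L p lambda kappa gamma alpha beta mu
               xs xbars u) :
  forall t : R, 0 <= t ->
    L2norm L (u t) <=
      expR (- (lambda1 * (lambda - mu * (L / N%:R) ^+ 2) + (mu / 4 - gamma))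
              * t) * L2norm L (u 0).
Proof.
have mu_ge0 : 0 <= mu.
  by rewrite -(@pmulr_lge0 _ 4^-1)// (le_trans (ltW gamma_gt0))// ltW.
have [ux [ut [u_cont ut_loc ut_der eqn]]] := u_sol.
have L0 := ltW L_gt0; have [uH _] := u_cont.
apply: L2norm_exponential_decay.
- by move=> t t0; exact: H10_squareIntegrable (uH t t0).
- exact: csqnorm_continuous u_cont.
apply: (energy_dini (form := cgl_form L p lambda kappa gamma alpha beta mu xs xbars)
  L0 u_cont ut_loc ut_der).
- apply: (@filterS _ _ (ae_filter_ringOfSetsType (@lebesgue_measure R))
    _ _ _ eqn) => t eqt t0 phi phi' phiH.
  have := eqt t0 phi phi' phiH; rewrite /cgl_form.
  set A := (lambda +i* alpha) * _; set B := (kappa +i* beta) * _.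
  set G := gamma%:C * _; set S := \sum_(k < N) _ => AE.
  rewrite (_ : ut t phi = (ut t phi + A + B - G) - (A + B - G)); last by ring.
  by rewrite AE mulNr; ring.
- by move=> w w'; exact: cgl_form_coercive.
- by move=> m; exact: cgl_form_bound.
Qed.
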